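(* Let $(M,\omega)$ be a compact Kähler manifold with a Hamiltonian action $\tau$ of $S^1$ with moment map $\phi:M\to\mathbb{R}$, and assume that $\tau$ extends to a holomorphic action of $\mathbb{C}^*$ on $M$, also denoted $\tau$. Let $\lambda\in\mathbb{R}$ be such that $S^1$ acts freely on $\phi^{-1}(\lambda)$. Let $M^\lambda_o=\{p\in M\mid\phi(p)<\lambda\}$, $M_{\mathrm{stable}}=\mathbb{C}^*\cdot\phi^{-1}(\lambda)$ and $M^\#=M^\lambda_o\cup M_{\mathrm{stable}}$. Let $F_i$, $i=1,\dots,k$, be the connected components of the set of critical points of $\phi$ (equivalently, of the fixed point set of $\tau$), and let $W_i$ be the unstable manifold of $\nabla\phi$ at $F_i$, i.e. $q\in W_i$ if and only if $\lim_{z\to 0}\tau_z(q)\in F_i$. Let $S$ be the set of indices $i$ for which $\phi(F_i)>\lambda$. Then $$M\setminus M^\#=\bigcup_{i\in S}W_i .$$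
   Context: Conventions: a moment map $\phi$ for a circle action with infinitesimal generator $\xi$ (of $\theta\mapsto\tau_{e^{i\theta}}$) satisfies $\iota_\xi\omega=-d\phi$; then the gradient $\nabla\phi$ with respect to the Kähler metric is the infinitesimal generator of the one-parameter group $t\mapsto\tau_{e^t}$. $\phi$ is constant on each component $F_i$, and $\phi(F_i)$ denotes this constant value. *)

(* Defs.v *)
From HB Require Import structures.
From mathcomp Require Import all_boot all_order all_algebra.
From mathcomp Require Import complex.
From mathcomp Require Import all_classical all_reals all_analysis.

Set Implicit Arguments.
Unset Strict Implicit.
Unset Printing Implicit Defensive.

Import Order.TTheory GRing.Theory Num.Theory.
Import numFieldNormedType.Exports.

Local Open Scope classical_set_scope.
Local Open Scope ring_scope.
Local Open Scope complex_scope.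

Section Smooth.
Context {R : realType} {V W : normedModType R}.

(* [U] is meant to be open and [V] finite-dimensional; then this is the usual
   class C^k, phrased with all directional derivatives. *)
Fixpoint Ck (k : nat) (U : set V) (f : V -> W) : Prop :=
  match k with
  | 0 => forall x, U x -> {for x, continuous f}
  | k'.+1 => (forall x, U x -> differentiable f x) /\
             forall v, Ck k' U ('D_v f)
  end.

Definition smooth (U : set V) (f : V -> W) : Prop := forall k, Ck k U f.

(* A smooth map is holomorphic for the complex structures [JV], [JW] when its
   differential is complex linear (Cauchy-Riemann equations). *)
Definition holomorphic (JV : V -> V) (JW : W -> W) (U : set V) (f : V -> W) :=
  smooth U f /\
  forall x v, U x -> 'D_(JV v) f x = JW ('D_v f x).

End Smooth.

(* The real vector space underlying C^n: x + i y is [row_mx x y]. *)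
Notation Cspace R n := 'rV[R]_(n + n).

(* i (x + i y) = - y + i x *)
Definition multJ {R : realType} {n : nat} (v : Cspace R n) : Cspace R n :=
  row_mx (- rsubmx v) (lsubmx v).

Definition bform {R : realType} {m : nat} (A : 'M[R]_m) (v w : 'rV[R]_m) : R :=
  (v *m A *m w^T) 0 0.

(* [chart_fun] and [chart_inv] are total functions; only their values on
   [chart_dom] and on [chart_img] matter. *)
Record chart (R : realType) (n : nat) (M : topologicalType) := Chart {
  chart_dom : set M;
  chart_fun :> M -> Cspace R n;
  chart_inv : Cspace R n -> M;
  chart_dom_open : open chart_dom;
  chart_img_open : open (chart_fun @` chart_dom);
  chart_funK : forall p, chart_dom p -> chart_inv (chart_fun p) = p;
  chart_fun_continuous :
    forall p, chart_dom p -> {for p, continuous chart_fun};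
  chart_inv_continuous :
    forall x, (chart_fun @` chart_dom) x -> {for x, continuous chart_inv}
}.

Definition chart_img R n M (c : chart R n M) : set (Cspace R n) :=
  c @` chart_dom c.

Section Kahler.
Context {R : realType} {n : nat} {M : topologicalType}.
Implicit Types (A : set (chart R n M)) (c d : chart R n M).

Record complex_atlas A : Prop := ComplexAtlas {
  atlas_cover : forall p, exists2 c, A c & chart_dom c p;
  atlas_transition : forall c d, A c -> A d ->
    holomorphic multJ multJ (c @` (chart_dom c `&` chart_dom d))
                (d \o chart_inv c)
}.

(* A 2-form is given in each chart [c] by the matrix [om c x] of its
   coefficients at the point of coordinates [x].  [preserves A om g] says
   g^* om = om; for [g = id] it says that the local expressions agree on the
   overlaps of the charts. *)
Definition preserves A (om : chart R n M -> Cspace R n -> 'M[R]_(n + n))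
    (g : M -> M) : Prop :=
  forall c d p, A c -> A d -> chart_dom c p -> chart_dom d (g p) ->
  forall v w,
    bform (om d (d (g p)))
          ('D_v (d \o g \o chart_inv c) (c p))
          ('D_w (d \o g \o chart_inv c) (c p))
    = bform (om c (c p)) v w.

Definition closed_form (U : set (Cspace R n))
    (w : Cspace R n -> 'M[R]_(n + n)) : Prop :=
  forall x a b e, U x ->
    'D_a (fun y => bform (w y) b e) x
    + 'D_b (fun y => bform (w y) e a) x
    + 'D_e (fun y => bform (w y) a b) x = 0.

(* The Kähler metric is g(v, w) = om(v, J w). *)
Record kahler_form A (om : chart R n M -> Cspace R n -> 'M[R]_(n + n)) : Prop :=
  KahlerForm {
  kahler_smooth : forall c, A c -> smooth (chart_img c) (om c);
  kahler_alternating :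
    forall c x, A c -> chart_img c x -> (om c x)^T = - om c x;
  kahler_compatible : preserves A om id;
  kahler_closed : forall c, A c -> closed_form (chart_img c) (om c);
  kahler_J_invariant : forall c x v w, A c -> chart_img c x ->
    bform (om c x) (multJ v) (multJ w) = bform (om c x) v w;
  kahler_positive : forall c x v, A c -> chart_img c x -> v != 0 ->
    0 < bform (om c x) v (multJ v)
}.

Record compact_kahler A (om : chart R n M -> Cspace R n -> 'M[R]_(n + n)) :
  Prop := CompactKahler {
  kahler_hausdorff : hausdorff_space M;
  kahler_compact : compact [set: M];
  kahler_atlas : complex_atlas A;
  kahler_kahler_form : kahler_form A om
}.

Definition toC (z : R * R) : R[i] := z.1 +i* z.2.

Definition multJ_prod (v : R * R * Cspace R n) : R * R * Cspace R n :=
  ((- v.1.2, v.1.1), multJ v.2).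

(* [tau z] is only meaningful for [z != 0]. The topology of C is the one of
   [R[i]^o]. *)
Record Cstar_holomorphic_action A (tau : R[i] -> M -> M) : Prop :=
  CstarHolomorphicAction {
  action1 : forall p, tau 1 p = p;
  actionM : forall z w p, z != 0 -> w != 0 -> tau (z * w) p = tau z (tau w p);
  action_continuous : forall (z : R[i]^o) p, z != 0 ->
    {for (z, p), continuous (fun q : R[i]^o * M => tau q.1 q.2)};
  action_holomorphic : forall c d, A c -> A d ->
    holomorphic multJ_prod multJ
      [set q : R * R * Cspace R n | [/\ q.1 != 0, chart_img c q.2 &
         chart_dom d (tau (toC q.1) (chart_inv c q.2))]]
      (fun q => d (tau (toC q.1) (chart_inv c q.2)))
}.

(* Coordinates, in [c], of the infinitesimal generator of
   theta |-> tau_(e^(i theta)). *)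
Definition generator (tau : R[i] -> M -> M) c (x : Cspace R n) : Cspace R n :=
  derive1 (fun theta : R =>
    c (tau (cos theta +i* sin theta) (chart_inv c x))) 0.

(* The action of the unit circle by the [tau z], [`|z| = 1], is Hamiltonian
   with moment map [phi]: iota_xi om = - d phi. *)
Record hamiltonian A (om : chart R n M -> Cspace R n -> 'M[R]_(n + n))
    (tau : R[i] -> M -> M) (phi : M -> R) : Prop := Hamiltonian {
  moment_smooth :
    forall c, A c -> smooth (chart_img c) (phi \o chart_inv c);
  circle_preserves : forall z : R[i], `|z| = 1 -> preserves A om (tau z);
  moment_map : forall c x v, A c -> chart_img c x ->
    bform (om c x) (generator tau c x) v = - 'D_v (phi \o chart_inv c) x
}.

Definition circle_acts_freely (tau : R[i] -> M -> M) (X : set M) : Prop :=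
  forall p (z : R[i]), X p -> `|z| = 1 -> tau z p = p -> z = 1.

Definition critical_points A (phi : M -> R) : set M :=
  [set p | forall c v, A c -> chart_dom c p ->
     'D_v (phi \o chart_inv c) (c p) = 0].

Definition components (X : set M) : set (set M) :=
  connected_component X @` X.

(* phi(F) = a, the notation presupposing that phi is constant on F. *)
Definition has_value (phi : M -> R) (F : set M) (a : R) : Prop :=
  phi @` F = [set a].

Definition Mo (phi : M -> R) (lambda : R) : set M :=
  [set p | phi p < lambda].

Definition Mstable (tau : R[i] -> M -> M) (phi : M -> R) (lambda : R) : set M :=
  [set tau z p | z in [set z | z != 0] & p in phi @^-1` [set lambda]].

Definition Msharp (tau : R[i] -> M -> M) (phi : M -> R) (lambda : R) : set M :=
  Mo phi lambda `|` Mstable tau phi lambda.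

Definition unstable (tau : R[i] -> M -> M) (F : set M) : set M :=
  [set q | exists2 p, F p & tau z q @[z --> (0 : R[i]^o)^'] --> p].

End Kahler.

(* Main.v *)
Require Import Defs.
From HB Require Import structures.
From mathcomp Require Import all_boot all_order all_algebra.
From mathcomp Require Import complex.
From mathcomp Require Import all_classical all_reals all_analysis.
From mathcomp Require Import ring lra.

Set Implicit Arguments.
Unset Strict Implicit.
Unset Printing Implicit Defensive.

Import Order.TTheory GRing.Theory Num.Theory.
Import numFieldNormedType.Exports.

Local Open Scope classical_set_scope.
Local Open Scope ring_scope.

(** Along the flow [t |-> tau_(e^t) q] the moment map is nondecreasing: its
    derivative is [om (eta, J eta)], where [eta] is the velocity in a chart.
    It is also invariant under the circle, so [phi (tau_z q)] is a nondecreasing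
    function of [|z|].

    If [tau_z q] tends, as [z] tends to 0, to a point where [phi] exceeds
    [lambda], then [phi > lambda] on the whole orbit of [q], which therefore does
    not meet [M^#] ([limit_above]).

    Conversely, let [q] be outside [M^#].  By the intermediate value theorem
    [phi > lambda] on the whole orbit ([not_Msharp_above]).  By compactness the
    points [tau_(e^t) q] accumulate, as [t] tends to [-oo], at some [p].  The
    moment map is constant on the orbit of [p], so [p] is critical
    ([alpha_limit_critical]) and fixed by the circle ([zero_fixed]); since the
    circle acts freely on the level [lambda], [phi p > lambda].  Two facts
    remain.

    - The orbit converges to [p] ([alpha_limit_converges]).  In a chart at [p],
      the average of the coordinates of [tau_z q] over a circle [|z| = r] is the
      constant coefficient of a Laurent series, hence does not depend on [r].
      Every limit point is fixed by the circle, so circles of the orbit that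
      pass near a limit point are small and close to their averages.  Hence the
      orbit cannot leave a neighbourhood of [p] once it is close enough to [p].
      [mean_displacement] proves this with averages over the [N]-th roots of
      unity, [N] tending to infinity, instead of integrals.

    - The moment map is constant on the component of [p] in the critical set.
      It is enough that critical points near [p] have the same critical value
      ([moment_near_fixed]).  In a chart at [p] let [g] be the rotation by the
      angle [2 pi / N].  Averaging a point over the iterates of [g] contracts the
      displacement [|g x - x|], a Newton iteration towards the fixed points of
      [g].  The differential of [phi] at [x] is bounded by the displacement of
      [x] as soon as [N] is large, so that, pushed by many averages, the segment
      from [p] to a nearby critical point becomes a path along which [phi]
      varies as little as desired ([periodic_fixed_points_level]). *)

(** * Calculus in finite-dimensional normed spaces *)

Section Calculus.
Context {R : realType}.

Lemma rV_norm_le m (x : 'rV[R]_m) (e : R) :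
  0 <= e -> (forall j, `|x 0 j| <= e) -> `|x| <= e.
Proof.
move=> e0 xe; rewrite [leLHS]/Num.Def.normr/= mx_normrE.
by apply: bigmax_le => // -[i j] _ /=; rewrite (ord1 i).
Qed.

Lemma rV_coord_le m (x : 'rV[R]_m) j : `|x 0 j| <= `|x|.
Proof.
rewrite [leRHS]/Num.Def.normr/= mx_normrE.
exact: (le_bigmax _ (fun i : 'I_1 * 'I_m => `|x i.1 i.2|) (0, j)).
Qed.

Lemma near_norm (V : normedModType R) (x0 : V) (P : set V) :
  (\forall x \near x0, P x) <->
  exists2 r : R, 0 < r & forall x, `|x - x0| < r -> P x.
Proof.
split=> [/nbhs_ballP[r r0 rP]|[r r0 rP]].
  by exists r => // x xr; apply: rP; rewrite -ball_normE /= distrC.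
by apply/nbhs_ballP; exists r => // x; rewrite -ball_normE /= distrC; exact: rP.
Qed.

Lemma is_derive_comp (V W : normedModType R) (c : R -> V) (dc : V) (f : V -> W)
    (t : R) : is_derive t 1 c dc -> differentiable f (c t) ->
  is_derive t 1 (f \o c) ('D_dc f (c t)).
Proof.
move=> cdc df.
have dct : differentiable c t by apply/derivable1_diffP; exact: ex_derive.
have dfc : differentiable (f \o c) t by exact: differentiable_comp.
apply: DeriveDef; first exact: diff_derivable.
by rewrite deriveE // diff_comp // deriveE //= -(deriveE _ dct) derive_val.
Qed.

Lemma is_derive_line (V : normedModType R) (b v : V) (t : R) :
  is_derive t 1 (fun s : R => b + s *: v) v.
Proof.
have df : is_diff t (fun s : R => b + s *: v) (fun s => 0 + s *: v).
  apply: is_diffD; exact: is_diff_scalel.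
have [dd dv] := df.
by apply: DeriveDef; [exact: diff_derivable|rewrite deriveE// dv add0r scale1r].
Qed.

Lemma is_derive_coord m (c : R -> 'rV[R]_m) dc (t : R) j : is_derive t 1 c dc ->
  is_derive t 1 (fun s => c s 0 j) (dc 0 j).
Proof.
move=> [dct <-]; have /derivable_mxP dcj := dct.
apply: DeriveDef; first exact: dcj.
by rewrite derive_mx // mxE.
Qed.

(** The norm is the maximum norm, so the real mean value theorem applies to each
    coordinate separately. *)
Lemma mvt_norm m (c dc : R -> 'rV[R]_m) (a b M : R) : a <= b ->
  (forall t : R, a <= t <= b -> is_derive t 1 c (dc t)) ->
  (forall t : R, a <= t <= b -> `|dc t| <= M) ->
  `|c b - c a| <= M * (b - a).
Proof.
move=> ab cdc dcM.
have M0 : 0 <= M by apply: le_trans (dcM a _); rewrite ?lexx ?ab.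
apply: rV_norm_le => [|j]; first by rewrite mulr_ge0 ?subr_ge0.
have dcj (t : R) : a <= t <= b -> is_derive t 1 (fun s => c s 0 j) (dc t 0 j).
  by move=> /cdc; exact: is_derive_coord.
have cdj : {within `[a, b], continuous (fun s => c s 0 j)}.
  by apply: derivable_within_continuous => t /[!in_itv] /= /dcj[].
have dcj' (t : R) : t \in `]a, b[ -> is_derive t 1 (fun s => c s 0 j) (dc t 0 j).
  by move=> /[!in_itv] /= /andP[at_ tb]; apply: dcj; rewrite !ltW.
have [t /[!in_itv] /= tab] := MVT_segment ab dcj' cdj.
rewrite !mxE => ->; rewrite normrM (ger0_norm (_ : 0 <= b - a)) ?subr_ge0//.
by rewrite ler_wpM2r ?subr_ge0// (le_trans (rV_coord_le _ _)) ?dcM.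
Qed.

Lemma derive_sum_delta m (W : normedModType R) (f : 'rV[R]_m -> W) x v :
  differentiable f x ->
  'D_v f x = \sum_(i < m) v 0 i *: 'D_(delta_mx 0 i) f x.
Proof.
move=> df; rewrite deriveE// {1}(row_sum_delta v) linear_sum.
by apply: eq_bigr => i _; rewrite linearZ deriveE.
Qed.

Lemma segment_ball (V : normedModType R) (x0 a b : V) (r t : R) :
  `|a - x0| < r -> `|b - x0| < r -> 0 <= t <= 1 ->
  `|b + t *: (a - b) - x0| < r.
Proof.
move=> ar br /andP[t0 t1].
have -> : b + t *: (a - b) - x0 = (1 - t) *: (b - x0) + t *: (a - x0).
  have -> : a - b = (a - x0) - (b - x0) by rewrite opprB addrA subrK.
  by rewrite addrAC [t *: _]scalerBr scalerBl scale1r [t *: _ - _]addrC addrA.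
have t1' : 0 <= 1 - t by rewrite subr_ge0.
apply: le_lt_trans (ler_normD _ _) _; rewrite !normrZ !ger0_norm//.
have [->|tn0] := eqVneq t 0; first by rewrite subr0 mul0r addr0 mul1r.
have tp : 0 < t by rewrite lt0r tn0.
have : (1 - t) * `|b - x0| <= (1 - t) * r by rewrite ler_wpM2l// ltW.
have : t * `|a - x0| < t * r by rewrite ltr_pM2l.
lra.
Qed.

(** Strict (Peano) differentiability: the increments between any two nearby points,
    and not only those from [x0], are approximated. *)
Definition strict_derivative m k (f : 'rV[R]_m -> 'rV[R]_k) (x0 : 'rV[R]_m)
    (B : 'rV[R]_m -> 'rV[R]_k) :=
  forall d : R, 0 < d -> exists2 r, 0 < r & forall a b,
    `|a - x0| < r -> `|b - x0| < r ->
    `|f a - f b - B (a - b)| <= d * `|a - b|.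

(** Mean value theorem for [t |-> f (b + t (a - b)) - t 'D_(a - b) f x0]. *)
Lemma C1_strict_derivative m k (f : 'rV[R]_m -> 'rV[R]_k) x0 :
  (\forall x \near x0, differentiable f x) ->
  (forall v, {for x0, continuous ('D_v f)}) ->
  strict_derivative f x0 (fun v => 'D_v f x0).
Proof.
move=> df cdf d d0.
pose d' := d / m.+1%:R.
have d'0 : 0 < d' by rewrite divr_gt0.
have nearD : \forall x \near x0, forall i : 'I_m,
    `|'D_(delta_mx 0 i) f x0 - 'D_(delta_mx 0 i) f x| <= d'.
  apply: (@filter_forall _ _ (fun (i : 'I_m) (x : 'rV[R]_m) =>
    `|'D_(delta_mx 0 i) f x0 - 'D_(delta_mx 0 i) f x| <= d')
    _ (nbhs_filter x0)) => i.
  by have /cvgrPdist_le := cdf (delta_mx 0 i); apply.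
have {}nearD : \forall x \near x0, differentiable f x /\ forall i : 'I_m,
    `|'D_(delta_mx 0 i) f x0 - 'D_(delta_mx 0 i) f x| <= d'.
  exact: filterI.
have [r r0 rP] := (near_norm _ _).1 nearD.
exists r => // a b ar br.
pose v := a - b.
pose c t := f (b + t *: v) - t *: 'D_v f x0.
pose dc (t : R) := 'D_v f (b + t *: v) - 'D_v f x0.
have seg (t : R) : 0 <= t <= 1 -> `|b + t *: v - x0| < r by exact: segment_ball.
have cdc (t : R) : 0 <= t <= 1 -> is_derive t 1 c (dc t).
  move=> t01; apply: is_deriveB.
    apply: (@is_derive_comp _ _ (fun s : R => b + s *: v) v).
      exact: is_derive_line.
    by have [] := rP _ (seg _ t01).
  have := is_derive_line 0 ('D_v f x0) t.
  by under eq_fun do rewrite add0r.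
have vi i : `|v 0 i| <= `|v| by exact: rV_coord_le.
have dcM (t : R) : 0 <= t <= 1 -> `|dc t| <= d * `|v|.
  move=> t01; have [dft Dt] := rP _ (seg _ t01).
  have dfx0 : differentiable f x0.
    by have [] := rP x0; rewrite ?subrr ?normr0.
  rewrite /dc !(derive_sum_delta v)// -sumrB.
  apply: le_trans (ler_norm_sum _ _ _) _.
  apply: (@le_trans _ _ (\sum_(i < m) `|v| * d')).
    apply: ler_sum => i _; rewrite -scalerBr normrZ ler_pM// distrC.
    exact: Dt.
  rewrite sumr_const card_ord -mulr_natl /d'.
  rewrite mulrCA [leRHS]mulrC ler_wpM2l// mulrCA ler_piMr ?(ltW d0)//.
  by rewrite ler_pdivrMr// mul1r ler_nat leqnSn.
have := mvt_norm ler01 cdc dcM.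
rewrite subr0 mulr1 /c !scale1r !scale0r subr0 addr0 /v.
by rewrite [b + _]addrC subrK addrAC.
Qed.

Lemma derive_bounded m (W : normedModType R) (f : 'rV[R]_m -> W) x :
  differentiable f x -> exists2 C, 0 <= C & forall v, `|'D_v f x| <= C * `|v|.
Proof.
move=> df; exists (\sum_(i < m) `|'D_(delta_mx 0 i) f x|).
  by apply: sumr_ge0.
move=> v; rewrite derive_sum_delta// mulr_suml.
apply: le_trans (ler_norm_sum _ _ _) _; apply: ler_sum => i _.
by rewrite normrZ mulrC ler_wpM2l// rV_coord_le.
Qed.

Lemma C1_lipschitz m k (f : 'rV[R]_m -> 'rV[R]_k) x0 :
  (\forall x \near x0, differentiable f x) ->
  (forall v, {for x0, continuous ('D_v f)}) ->
  exists2 L, 0 <= L & exists2 r, 0 < r & forall a b,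
    `|a - x0| < r -> `|b - x0| < r -> `|f a - f b| <= L * `|a - b|.
Proof.
move=> df cdf.
have [r r0 rP] := C1_strict_derivative df cdf ltr01.
have [C C0 CP] := derive_bounded (nbhs_singleton df).
exists (C + 1); first by rewrite addr_ge0.
exists r => // a b ar br; rewrite mulrDl.
rewrite -(subrK ('D_(a - b) f x0) (f a - f b)) addrC.
apply: le_trans (ler_normD _ _) _; rewrite lerD ?rP//.
Qed.

(** The integral curve [c] of an [L]-Lipschitz field over a time [h <= 1 / (4 L)]:
    at the point farthest from [c 0] the mean value inequality bounds the distance
    by the initial speed, and this bounds the deviation from the tangent line.
    In particular [c] is constant when the field vanishes at [c 0]. *)
Lemma short_time_flow m (X : 'rV[R]_m -> 'rV[R]_m) (c : R -> 'rV[R]_m) (L h : R) :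
  0 <= h -> 0 <= L -> h * L <= 4^-1 ->
  (forall t : R, 0 <= t <= h -> is_derive t 1 c (X (c t))) ->
  (forall t : R, 0 <= t <= h -> `|X (c t) - X (c 0)| <= L * `|c t - c 0|) ->
  (forall t : R, 0 <= t <= h -> `|c t - c 0| <= 2 * h * `|X (c 0)|) /\
  `|c h - c 0 - h *: X (c 0)| <= 2 * h ^+ 2 * L * `|X (c 0)|.
Proof.
move=> h0 L0 hL cX XL.
have [t0 t0h t0max] : exists2 t0, t0 \in `[0, h] &
    forall t, t \in `[0, h] -> `|c t - c 0| <= `|c t0 - c 0|.
  apply: EVT_max => //; apply: continuous_in_subspaceT => t.
  rewrite inE/= in_itv/= => /cX[dct _].
  apply: cvg_norm; apply: cvgB; last exact: cvg_cst.
  by apply: differentiable_continuous; apply/derivable1_diffP.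
rewrite in_itv /= in t0h.
have bnd (t : R) : 0 <= t <= h -> `|c t - c 0| <= 2 * h * `|X (c 0)|.
  move=> th; apply: (le_trans (t0max t _)); first by rewrite in_itv.
  have t0h' (s : R) : 0 <= s <= t0 -> 0 <= s <= h.
    by move=> /andP[-> st]; case/andP: t0h => _; apply: le_trans.
  have := @mvt_norm m c (fun t => X (c t)) 0 t0 (`|X (c 0)| + L * `|c t0 - c 0|) _ _ _.
  have [t00 t0h1] := andP t0h.
  move=> /(_ t00 (fun s sh => cX s (t0h' s sh))) => H.
  have {}H : `|c t0 - c 0| <= (`|X (c 0)| + L * `|c t0 - c 0|) * t0.
    rewrite -[X in _ * X]subr0; apply: H => s /t0h' sh.
    rewrite -(subrK (X (c 0)) (X (c s))) addrC.
    apply: le_trans (ler_normD _ _) _; rewrite lerD2l.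
    apply: le_trans (XL s sh) _; rewrite ler_wpM2l// t0max// in_itv//.
  set D := `|c t0 - c 0| in H *; set E := `|X (c 0)| in H *.
  have D0 : 0 <= D by exact: normr_ge0.
  have E0 : 0 <= E by exact: normr_ge0.
  have H1 : (E + L * D) * t0 <= (E + L * D) * h.
    by rewrite ler_wpM2l// addr_ge0// mulr_ge0.
  have H2 : (h * L) * D <= 4^-1 * D by rewrite ler_wpM2r.
  have H3 : 0 <= h * E by rewrite mulr_ge0.
  nra.
split=> //.
have h1 : is_true (0 <= h <= h) by rewrite h0 lexx.
pose c1 t := c t - t *: X (c 0).
have := @mvt_norm m c1 (fun t => X (c t) - X (c 0)) 0 h
   (L * (2 * h * `|X (c 0)|)) h0 _ _.
rewrite /c1 scale0r !subr0 addrAC => H.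
have -> : 2 * h ^+ 2 * L * `|X (c 0)| = L * (2 * h * `|X (c 0)|) * h by ring.
apply: H => t th.
  apply: is_deriveB; first exact: cX.
  have := is_derive_line 0 (X (c 0)) t.
  by under eq_fun do rewrite add0r.
by apply: le_trans (XL t th) _; rewrite ler_wpM2l// bnd.
Qed.

End Calculus.

(** * Levels of a function on the fixed points of a periodic map *)

Section Newton.
Context {R : realType}.

(** Cut [0, 1] into [N] equal parts: the quadratic terms add up to [b / N]. *)
Lemma quadratic_increment (f : R -> R) (a b : R) : 0 <= b ->
  (forall s t : R, 0 <= s <= 1 -> 0 <= t <= 1 ->
     `|f s - f t| <= a * `|s - t| + b * `|s - t| ^+ 2) ->
  `|f 1 - f 0| <= a.
Proof.
move=> b0 fab.
suff H N : `|f 1 - f 0| <= a + b / N.+1%:R.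
  apply/ler_addgt0Pr => e e0.
  pose N := Num.bound (b / e).
  apply: le_trans (H N) _; rewrite lerD2l ler_pdivrMr// mulrC -ler_pdivrMr//.
  apply: (@le_trans _ _ N%:R); last by rewrite ler_nat.
  by rewrite ltW// archi_boundP// divr_ge0// ltW.
pose p (j : nat) : R := j%:R / N.+1%:R.
have pN : p N.+1 = 1 by rewrite /p divff.
have p0 : p 0 = 0 by rewrite /p mul0r.
have -> : f 1 - f 0 = \sum_(0 <= j < N.+1) (f (p j.+1) - f (p j)).
  by rewrite (telescope_sumr (fun j => f (p j)))// pN p0.
apply: le_trans (ler_norm_sum _ _ _) _.
have -> : a + b / N.+1%:R =
    \sum_(0 <= j < N.+1) (a / N.+1%:R + b / N.+1%:R ^+ 2).
  rewrite sumr_const_nat subn0 -[RHS]mulr_natl.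
  have := pnatr_eq0 R N.+1; set n := N.+1%:R => /negbT n0; by field.
rewrite big_nat [leRHS]big_nat; apply: ler_sum => j /andP[_ jN].
have p01 i : (i <= N.+1)%N -> 0 <= p i <= 1.
  by move=> iN; rewrite divr_ge0//= ler_pdivrMr// mul1r ler_nat.
have := fab (p j.+1) (p j) (p01 _ jN) (p01 _ (ltnW jN)).
have -> : p j.+1 - p j = N.+1%:R^-1.
  by rewrite /p -mulrBl -natrB// subSnn mul1r.
by rewrite (ger0_norm (_ : 0 <= N.+1%:R^-1)) ?invr_ge0// exprVn.
Qed.

(** Let [m_] be the average over the iterates of [g] and [D a = g a - a].  As [g]
    has order [N], the sum of [D] over an orbit vanishes, so that [D (m_ a)] is an
    average of the deviations of [g] from its derivative [B]: for any [d], near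
    [x0], [|D (m_ a)| <= d * O(|D a|)].  On the other hand [m_] is [P]-Lipschitz,
    with [P = K ^ N].  The constant [d] is taken so small that [m_] multiplies [D]
    by at most [1 / (2 P)].  The [k]-th iterate of [m_] fixes the fixed points [x0]
    and [x], and turns the segment between them into a path that is
    [P ^ k]-Lipschitz with displacements [O((2 P) ^ - k)].  By the bound on the
    increments of [f], its variation on this path is [O(2 ^ - k)]. *)
Lemma periodic_fixed_points_level m (g : 'rV[R]_m -> 'rV[R]_m)
    (f : 'rV[R]_m -> R) (B : {linear 'rV[R]_m -> 'rV[R]_m})
    (x0 : 'rV[R]_m) (N : nat) (C K r0 : R) :
  0 < r0 -> (0 < N)%N -> 0 <= C -> 1 <= K ->
  g x0 = x0 ->
  strict_derivative g x0 B ->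
  (forall a b, `|a - x0| < r0 -> `|b - x0| < r0 ->
    `|g a - g b| <= K * `|a - b|) ->
  (forall a, `|a - x0| < r0 -> iter N g a = a) ->
  (forall a b, `|a - x0| < r0 -> `|b - x0| < r0 ->
    `|f a - f b| <= C * (`|g a - a| + `|a - b|) * `|a - b|) ->
  \forall x \near x0, g x = x -> f x = f x0.
Proof.
move=> r00 N0 C0 K1 gx0 gB gK gN fC.
have NR : 0 < N%:R :> R by rewrite ltr0n.
have K0 : 0 < K by apply: lt_le_trans K1.
pose P := K ^+ N.
have P1 : 1 <= P by rewrite exprn_ege1.
have P0 : 0 < P by apply: lt_le_trans P1.
pose Q := N%:R * P.
have Q0 : 0 < Q by rewrite mulr_gt0.
pose D a := g a - a.
pose m_ a := N%:R^-1 *: \sum_(j < N) iter j g a.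
have KP j : (j <= N)%N -> K ^+ j <= P by move=> jN; rewrite ler_weXn2l.
(* the iterates of [g] of order at most [N], near [x0] *)
have itB a b j : `|a - x0| < r0 / P -> `|b - x0| < r0 / P -> (j <= N)%N ->
    `|iter j g a - iter j g b| <= K ^+ j * `|a - b|.
  have near_iter c i : `|c - x0| < r0 / P -> (i <= N)%N ->
      `|iter i g c - x0| <= K ^+ i * `|c - x0| -> `|iter i g c - x0| < r0.
    move=> cr iN /le_lt_trans; apply.
    apply: (@le_lt_trans _ _ (P * `|c - x0|)); first by rewrite ler_wpM2r// KP.
    by rewrite mulrC -ltr_pdivlMr.
  have itx0 i : iter i g x0 = x0 by elim: i => //= i ->.
  have it0 c i : `|c - x0| < r0 / P -> (i <= N)%N ->
      `|iter i g c - x0| <= K ^+ i * `|c - x0|.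
    move=> cr; elim: i => [_|i IH iN]; first by rewrite expr0 mul1r.
    have {}IH := IH (ltnW iN).
    rewrite -{1}gx0 exprS -mulrA /=; apply: le_trans (gK _ _ _ _) _.
    - exact: near_iter (ltnW iN) IH.
    - by rewrite subrr normr0.
    - by rewrite ler_wpM2l// ltW.
  move=> ar br; elim: j => [_|j IH jN]; first by rewrite expr0 mul1r.
  have {}IH := IH (ltnW jN).
  rewrite exprS -mulrA /=; apply: le_trans (gK _ _ _ _) _.
  - by apply: near_iter (ltnW jN) _ => //; apply: it0 (ltnW jN).
  - by apply: near_iter (ltnW jN) _ => //; apply: it0 (ltnW jN).
  - by rewrite ler_wpM2l// ltW.
have itx0 i : iter i g x0 = x0 by elim: i => //= i ->.
have x0r : `|x0 - x0| < r0 / P by rewrite subrr normr0 divr_gt0.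
have rP a : `|a - x0| < r0 / P -> `|a - x0| < r0.
  by move=> /lt_le_trans; apply; rewrite ler_pdivrMr// ler_peMr// ltW.
have near_it a j : `|a - x0| < r0 / P -> (j <= N)%N ->
    `|iter j g a - x0| <= P * `|a - x0|.
  move=> ar jN; rewrite -{1}(itx0 j); apply: le_trans (itB _ _ _ ar x0r jN) _.
  by rewrite ler_wpM2r// KP.
have avgc (c : 'rV[R]_m) : N%:R^-1 *: (c *+ N) = c.
  by rewrite -[c *+ N]scaler_nat scalerA mulVf ?scale1r// gt_eqF.
have m_avg a (c : 'rV[R]_m) : m_ a - c = N%:R^-1 *: \sum_(j < N) (iter j g a - c).
  by rewrite sumrB sumr_const card_ord scalerBr avgc.
have avg_le (u : 'I_N -> 'rV[R]_m) e : (forall j, `|u j| <= e) ->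
    `|N%:R^-1 *: \sum_(j < N) u j| <= e.
  move=> ue; rewrite normrZ ger0_norm ?invr_ge0 ?ler0n//.
  rewrite ler_pdivrMl//; apply: le_trans (ler_norm_sum _ _ _) _.
  apply: (@le_trans _ _ (\sum_(j < N) e)); first exact: ler_sum.
  by rewrite sumr_const card_ord mulr_natl.
have mP a b : `|a - x0| < r0 / P -> `|b - x0| < r0 / P ->
    `|m_ a - m_ b| <= P * `|a - b|.
  move=> ar br; rewrite /m_ -scalerBr -sumrB; apply: avg_le => j.
  apply: le_trans (itB _ _ _ ar br (ltnW (ltn_ord j))) _.
  by rewrite ler_wpM2r// KP// ltnW.
have itD a j : `|a - x0| < r0 / P -> `|g a - x0| < r0 / P -> (j <= N)%N ->
    `|iter j g a - a| <= Q * `|D a|.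
  move=> ar gar jN.
  have : `|iter j g a - a| <= j%:R * (P * `|D a|).
    elim: j jN => [_|j IH jN]; first by rewrite subrr normr0 mul0r.
    rewrite -(subrKA (iter j g a)); apply: le_trans (ler_normD _ _) _.
    rewrite -[in leRHS]addn1 natrD mulrDl addrC lerD ?IH 1?ltnW// mul1r.
    rewrite iterSr; apply: le_trans (itB _ _ _ gar ar (ltnW jN)) _.
    by rewrite ler_wpM2r// KP// ltnW.
  by move/le_trans; apply; rewrite mulrA ler_wpM2r// /Q ler_wpM2r ?ler_nat// ltW.
clearbody Q P.
have mx0 : m_ x0 = x0.
  apply/eqP; rewrite -subr_eq0 m_avg big1 ?scaler0// => j _.
  by rewrite itx0 subrr.
(* [d] makes the average contract the displacement by [1 / (2 P)] *)
pose d := (4 * Q * P)^-1.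
have d0 : 0 < d by rewrite invr_gt0 !mulr_gt0.
have [r1 r10 gB1] := gB d d0.
pose r2 := Num.min r0 r1.
have r20 : 0 < r2 by rewrite lt_min r00.
pose r := r2 / P / K.
have r_gt0 : 0 < r by rewrite !divr_gt0.
have rP2 a : `|a - x0| < r -> `|a - x0| < r2 / P.
  by move=> /lt_le_trans; apply; rewrite ler_pdivrMr// ler_peMr// ltW// divr_gt0.
have rr0 a : `|a - x0| < r2 / P -> `|a - x0| < r0 / P.
  by move=> /lt_le_trans; apply; rewrite ler_wpM2r ?invr_ge0 ?(ltW P0)// ge_min lexx.
have gr a : `|a - x0| < r -> `|g a - x0| < r0 / P.
  move=> ar; have ar0 := rP _ (rr0 _ (rP2 _ ar)); apply: rr0.
  rewrite -{1}gx0; apply: le_lt_trans (gK _ _ ar0 _) _.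
    by rewrite subrr normr0.
  by rewrite mulrC -ltr_pdivlMr.
have mD a : `|a - x0| < r -> `|m_ a - a| <= Q * `|D a|.
  move=> ar; rewrite m_avg; apply: avg_le => j.
  by apply: itD; [exact/rr0/rP2|exact: gr|exact/ltnW/ltn_ord].
have r2r1 a j : `|a - x0| < r -> (j <= N)%N -> `|iter j g a - x0| < r1.
  move=> /rP2 ar jN; apply: le_lt_trans (near_it _ _ (rr0 _ ar) jN) _.
  rewrite mulrC -ltr_pdivlMr//; apply: lt_le_trans ar _.
  by rewrite ler_wpM2r ?invr_ge0 ?(ltW P0)// ge_min lexx orbT.
have mr1 a : `|a - x0| < r -> `|m_ a - x0| < r1.
  move=> /rP2 ar; rewrite -mx0; apply: le_lt_trans (mP _ _ (rr0 _ ar) x0r) _.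
  rewrite mulrC -ltr_pdivlMr//; apply: lt_le_trans ar _.
  by rewrite ler_wpM2r ?invr_ge0 ?(ltW P0)// ge_min lexx orbT.
have Dm a : `|a - x0| < r -> `|D (m_ a)| <= (2 * P)^-1 * `|D a|.
  move=> ar; have gNa := gN a (rP _ (rr0 _ (rP2 _ ar))).
  have shift_avg : \sum_(j < N) g (iter j g a) = \sum_(j < N) iter j g a.
    case: (N) N0 gNa => // N' _ gNa.
    by rewrite big_ord_recr [RHS]big_ord_recl /= -iterS gNa addrC.
  have -> : D (m_ a) = N%:R^-1 *: \sum_(j < N)
      (g (m_ a) - g (iter j g a) - B (m_ a - iter j g a)).
    rewrite !sumrB -linear_sum shift_avg sumrB !sumr_const card_ord.
    rewrite !scalerBr -linearZ/= scalerBr -/(m_ a) !avgc.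
    by rewrite subrr linear0 subr0.
  apply: avg_le => j.
  apply: le_trans (gB1 _ _ (mr1 _ ar) (r2r1 _ _ ar (ltnW (ltn_ord j)))) _.
  have H1 := itD _ j (rr0 _ (rP2 _ ar)) (gr _ ar) (ltnW (ltn_ord j)).
  apply: (@le_trans _ _ (d * (Q * `|D a| + Q * `|D a|))).
    rewrite ler_wpM2l ?(ltW d0)// -(subrKA a); apply: le_trans (ler_normD _ _) _.
    by rewrite lerD ?mD// distrC.
  rewrite -mulrDl mulrA ler_wpM2r// /d le_eqVlt; apply/orP; left; apply/eqP.
  by field; rewrite !gt_eqF.
have mL k a b : (forall i, (i < k)%N -> `|iter i m_ a - x0| < r) ->
    (forall i, (i < k)%N -> `|iter i m_ b - x0| < r) ->
    `|iter k m_ a - iter k m_ b| <= P ^+ k * `|a - b|.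
  elim: k => [_ _|k IH ak bk]; first by rewrite expr0 mul1r.
  rewrite /= exprS -mulrA; apply: le_trans (mP _ _ _ _) _.
  - exact/rr0/rP2/ak.
  - exact/rr0/rP2/bk.
  - rewrite ler_wpM2l ?(ltW P0)//; apply: IH => i ik.
      by apply: ak; rewrite ltnS ltnW.
    by apply: bk; rewrite ltnS ltnW.
pose rho := r / (1 + 2 * Q * (K + 1)).
have den0 : 0 < 1 + 2 * Q * (K + 1) by rewrite addr_gt0// !mulr_gt0// addr_gt0.
have rho0 : 0 < rho by rewrite divr_gt0.
have rhor a : `|a - x0| < rho -> `|a - x0| < r.
  move=> /lt_le_trans; apply; rewrite ler_pdivrMr// ler_peMr// ?(ltW r_gt0)//.
  by rewrite lerDl ltW// !mulr_gt0// addr_gt0.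
have Dle a : `|a - x0| < rho -> `|D a| <= (K + 1) * `|a - x0|.
  move=> /rhor /rP2 /rr0 /rP ar.
  rewrite /D -(subrKA x0) mulrDl mul1r; apply: le_trans (ler_normD _ _) _.
  rewrite lerD//; last by rewrite distrC.
  by rewrite -{1}gx0; apply: gK; rewrite // subrr normr0.
have close k a : `|a - x0| < rho ->
    `|iter k m_ a - a| <= 2 * Q * (1 - 2^-1 ^+ k) * `|D a| ->
    `|iter k m_ a - x0| < r.
  move=> arho H; have Da := Dle a arho.
  rewrite -(subrKA a); apply: le_lt_trans (ler_normD _ _) _.
  apply: (@le_lt_trans _ _ ((1 + 2 * Q * (K + 1)) * `|a - x0|)); last first.
    by rewrite mulrC -ltr_pdivlMr.
  rewrite mulrDl mul1r addrC lerD2l; apply: le_trans H _.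
  rewrite -!mulrA ler_wpM2l// ler_wpM2l ?(ltW Q0)//.
  by apply: le_trans Da; rewrite ler_piMl// gerBl.
have newton k a : `|a - x0| < rho ->
    `|iter k m_ a - a| <= 2 * Q * (1 - 2^-1 ^+ k) * `|D a| /\
    `|D (iter k m_ a)| <= (2 * P)^-1 ^+ k * `|D a|.
  move=> arho; have ar := rhor a arho; have Da := Dle a arho.
  have Da0 : 0 <= `|D a| by [].
  elim: k => [|k [IH1 IH2]].
    by rewrite /= !expr0 !subrr mulr0 normr0 mul0r mul1r.
  have ur : `|iter k m_ a - x0| < r by exact: close.
  split=> /=.
    rewrite -(subrKA (iter k m_ a)); apply: le_trans (ler_normD _ _) _.
    apply: (@le_trans _ _ (Q * (2^-1 ^+ k * `|D a|) +
        2 * Q * (1 - 2^-1 ^+ k) * `|D a|)).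
      rewrite lerD//; apply: le_trans (mD _ ur) _; rewrite ler_wpM2l ?(ltW Q0)//.
      apply: le_trans IH2 _; rewrite ler_wpM2r//.
      rewrite lerXn2r ?nnegrE ?invr_ge0 ?mulr_ge0 ?(ltW P0)//.
      by rewrite lef_pV2 ?posrE ?mulr_gt0// ler_peMr.
    by rewrite exprS le_eqVlt; apply/orP; left; apply/eqP; field.
  rewrite exprS -mulrA; apply: le_trans (Dm _ ur) _.
  by rewrite ler_wpM2l// invr_ge0 mulr_ge0// ltW.
have newton_r k a : `|a - x0| < rho -> `|iter k m_ a - x0| < r.
  by move=> arho; apply: close => //; have [] := newton k a arho.
apply/near_norm; exists rho => // x xrho gx.
have Dx : D x = 0 by rewrite /D gx subrr.
have mkx k : iter k m_ x = x.
  have [H _] := newton k x xrho.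
  by apply/eqP; rewrite -subr_eq0 -normr_le0 (le_trans H)// Dx normr0 mulr0.
have mkx0 k : iter k m_ x0 = x0 by elim: k => //= k ->.
pose c := C * (K + 1) * `|x - x0| ^+ 2.
have level k : `|f x - f x0| <= c * 2^-1 ^+ k.
  pose y (s : R) := x0 + s *: (x - x0).
  have -> : f x - f x0 = f (iter k m_ (y 1)) - f (iter k m_ (y 0)).
    have -> : y 1 = x by rewrite /y scale1r addrC subrK.
    by have -> : y 0 = x0; [rewrite /y scale0r addr0|rewrite mkx mkx0].
  apply: (@quadratic_increment (fun s => f (iter k m_ (y s))) _
    (C * (P ^+ k * `|x - x0|) ^+ 2)).
    by rewrite mulr_ge0// sqr_ge0.
  move=> s t s01 t01.
  have yr (u : R) : 0 <= u <= 1 -> `|y u - x0| < rho.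
    by move=> u01; apply: segment_ball => //; rewrite subrr normr0.
  have near0 (u : R) i : 0 <= u <= 1 -> `|iter i m_ (y u) - x0| < r0.
    by move=> /yr /newton_r ur; exact/rP/rr0/rP2.
  apply: le_trans (fC _ _ (near0 _ _ s01) (near0 _ _ t01)) _.
  have st : `|iter k m_ (y s) - iter k m_ (y t)| <=
      P ^+ k * `|x - x0| * `|s - t|.
    apply: le_trans (mL k _ _ _ _) _.
    - by move=> i _; exact/newton_r/yr.
    - by move=> i _; exact/newton_r/yr.
    - rewrite /y opprD addrACA subrr add0r -scalerBl normrZ.
      by rewrite [`|s - t| * _]mulrC mulrA.
  have [_ Ds] := newton k _ (yr _ s01).
  have {}Ds : `|D (iter k m_ (y s))| <= (2 * P)^-1 ^+ k * ((K + 1) * `|x - x0|).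
    apply: le_trans Ds _; rewrite ler_wpM2l ?exprn_ge0 ?invr_ge0 ?mulr_ge0 ?(ltW P0)//.
    apply: le_trans (Dle _ (yr _ s01)) _; rewrite ler_wpM2l ?addr_ge0 ?(ltW K0)//.
    rewrite /y addrAC subrr add0r normrZ ler_piMl//.
    by case/andP: s01 => s0 s1; rewrite ger0_norm.
  set S := `|s - t| in st *; set d1 := `|x - x0| in st Ds *.
  apply: (@le_trans _ _ (C * ((2 * P)^-1 ^+ k * ((K + 1) * d1) +
      P ^+ k * d1 * S) * (P ^+ k * d1 * S))).
    rewrite ler_pM// ?mulr_ge0// ?addr_ge0//.
    by rewrite ler_wpM2l// lerD.
  rewrite le_eqVlt; apply/orP; left; apply/eqP.
  rewrite exprVn exprMn exprVn /c -/d1.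
  have Pk : P ^+ k != 0 by rewrite expf_neq0// gt_eqF.
  have tk : (2 : R) ^+ k != 0 by rewrite expf_neq0// pnatr_eq0.
  by field; rewrite Pk tk.
apply/eqP; rewrite -subr_eq0 -normr_le0.
apply/ler_addgt0Pr => e e0; rewrite add0r.
have c0 : 0 <= c by rewrite !mulr_ge0 ?sqr_ge0 ?addr_ge0// ltW.
pose k := Num.bound (c / e).
apply: le_trans (level k) _.
rewrite exprVn ler_pdivrMr ?exprn_gt0// -ler_pdivrMl// mulrC.
apply: (@le_trans _ _ k%:R); first by rewrite ltW// archi_boundP// divr_ge0// ltW.
by rewrite -natrX ler_nat ltnW// ltn_expl.
Qed.

End Newton.

(** * Polar coordinates in the complex plane *)

Local Open Scope complex_scope.

Section ComplexPlane.
Context {R : realType}.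
Implicit Types (z w : R[i]) (s t : R).

(** [ray] and [cir] parametrize the positive reals and the unit circle, as pairs,
    since the action is smooth in the real coordinates of [z]. *)
Definition ray t : R * R := (expR t, 0).
Definition cir t : R * R := (cos t, sin t).

Lemma toC_rayD s t : toC (ray (s + t)) = toC (ray s) * toC (ray t).
Proof. by apply/eqP; rewrite eq_complex /= expRD !mulr0 !mul0r subr0 addr0 !eqxx. Qed.

Lemma toC_cirD s t : toC (cir (s + t)) = toC (cir s) * toC (cir t).
Proof.
apply/eqP; rewrite eq_complex /= cosD sinD eqxx /=.
by rewrite addrC.
Qed.

Lemma norm_toC_cir t : `|toC (cir t)| = 1.
Proof. by rewrite normc_def /= cos2Dsin2 sqrtr1. Qed.

Lemma norm_toC_ray t : `|toC (ray t)| = (expR t)%:C.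
Proof. by rewrite normc_def /= expr0n /= addr0 sqrtr_sqr ger0_norm ?expR_ge0. Qed.

Lemma toC_ray_neq0 t : toC (ray t) != 0.
Proof. by rewrite -normr_eq0 norm_toC_ray eq_complex/= eqxx andbT gt_eqF ?expR_gt0. Qed.

Lemma toC_cir_neq0 t : toC (cir t) != 0.
Proof. by rewrite -normr_eq0 norm_toC_cir oner_eq0. Qed.

Lemma unit_circleE z : `|z| = 1 -> exists2 t, 0 <= t <= pi *+ 2 & z = toC (cir t).
Proof.
case: z => a b; rewrite normc_def /= => -[] ab1.
have {}ab1 : a ^+ 2 + b ^+ 2 = 1.
  by rewrite -[LHS]sqr_sqrtr ?addr_ge0 ?sqr_ge0// ab1 expr1n.
have a1 : -1 <= a <= 1.
  rewrite -ler_norml -(@ler_sqr _ `|a|) ?nnegrE// expr1n real_normK ?num_real//.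
  by rewrite -ab1 lerDl sqr_ge0.
have sb : sin (acos a) = `|b|.
  rewrite sin_acos// -sqrtr_sqr; congr Num.sqrt; rewrite -ab1; ring.
have ca : cos (acos a) = a by rewrite acosK// in_itv.
have p0 := @pi_ge0 R.
have ap := acos_lepi a1; have a0 := acos_ge0 a1.
have [b0|b0] := leP 0 b.
  exists (acos a); last by rewrite /toC /= ca sb ger0_norm.
  by rewrite a0 (le_trans ap)// mulr2n lerDl.
exists (pi *+ 2 - acos a).
  by rewrite subr_ge0 (le_trans ap) ?mulr2n ?lerDl//= gerBl.
rewrite /toC /= cosB sinB cos2pi sin2pi ca sb ltr0_norm// !mul1r !mul0r addr0 sub0r.
by rewrite opprK.
Qed.

Lemma polar z : z != 0 ->
  exists t, exists2 s, 0 <= s <= pi *+ 2 & z = toC (ray t) * toC (cir s).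
Proof.
move=> z0; have [r r0 rE] : exists2 r : R, 0 < r & `|z| = r%:C.
  move: z0; rewrite -normr_gt0; case: `|z| => a b.
  by rewrite ltcE /= => /andP[/eqP-> a0]; exists a.
have rC : toC (ray (ln r)) = r%:C by rewrite /toC /= lnK ?posrE.
have r0' : r%:C != 0 by rewrite eq_complex/= eqxx andbT gt_eqF.
have [|s s0 zs] := @unit_circleE (z / r%:C).
  by rewrite normf_div rE ger0_norm ?divff// lecE /= eqxx ltW.
by exists (ln r), s => //; rewrite -zs rC mulrCA divff// mulr1.
Qed.

Lemma toC_continuous : continuous (toC : R * R -> R[i]^o).
Proof.
move=> z; apply/cvgrPdist_lt => -[e e'].
rewrite ltcE/= => /andP[/eqP -> e0].
near=> w.
rewrite normc_def ltcE /= eqxx /=.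
have -> : z.1 - w.1 = (z - w).1 by [].
have -> : z.2 - w.2 = (z - w).2 by [].
have zw : `|z - w| < e / 2.
  by near: w; apply: cvgr_dist_lt => //; rewrite divr_gt0.
have [z1 z2] : `|(z - w).1| < e / 2 /\ `|(z - w).2| < e / 2.
  by move: zw; rewrite prod_normE gt_max => /andP[].
set x := (z - w).1 in z1 *; set y := (z - w).2 in z2 *.
rewrite -[ltRHS]ger0_norm ?(ltW e0)// -sqrtr_sqr ltr_sqrt ?exprn_gt0//.
rewrite -(real_normK (num_real x)) -(real_normK (num_real y)).
have x0 : 0 <= `|x| by []. have y0 : 0 <= `|y| by [].
nra.
Unshelve. all: by end_near. Qed.

(** The disc [|z| < e^T] is a neighbourhood of 0. *)
Lemma near_zero_polar (P : R[i] -> Prop) (T : R) :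
  (forall t s, t < T -> 0 <= s <= pi *+ 2 -> P (toC (ray t) * toC (cir s))) ->
  \forall z \near (0 : R[i]^o)^', P z.
Proof.
move=> PT; rewrite near_withinE.
apply/nbhs_ballP; exists (expR T)%:C => /=; first by rewrite ltcE /= eqxx expR_gt0.
move=> z; rewrite -ball_normE /= sub0r normrN => zT z0.
have [t [s s0 zE]] := polar z0.
rewrite zE; apply: PT => //; rewrite -ltr_expR.
by move: zT; rewrite zE normrM norm_toC_ray norm_toC_cir mulr1 ltcE/= => /andP[].
Qed.

Lemma ray_near_zero (P : R[i] -> Prop) :
  (\forall z \near (0 : R[i]^o)^', P z) -> exists T, forall t, t < T -> P (toC (ray t)).
Proof.
rewrite near_withinE => /nbhs_ballP[[e e'] /=]; rewrite ltcE/= => /andP[/eqP -> e0] eP.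
exists (ln e) => t te; apply: eP; last exact: toC_ray_neq0.
rewrite -ball_normE /= sub0r normrN norm_toC_ray ltcE/= eqxx/=.
by rewrite -ltr_ln ?posrE ?expR_gt0// expRK.
Qed.

Lemma is_derive_pair (V W : normedModType R) (f : R -> V) (g : R -> W) df dg t :
  is_derive t 1 f df -> is_derive t 1 g dg ->
  is_derive t 1 (fun x => (f x, g x)) (df, dg).
Proof.
move=> [fd <-] [gd <-].
have fd' : differentiable f t by apply/derivable1_diffP.
have gd' : differentiable g t by apply/derivable1_diffP.
have pd := differentiable_pair fd' gd'.
apply: DeriveDef; first exact: diff_derivable.
by rewrite deriveE// diff_pair//= !deriveE.
Qed.

Lemma is_derive_ray : is_derive (0 : R) 1 ray (1, 0).
Proof.
have H1 : is_derive (0 : R) 1 (@expR R) 1.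
  by rewrite -[X in is_derive _ _ _ X]expR0; exact: is_derive_expR.
exact: (is_derive_pair H1 (is_derive_cst (0 : R) (0 : R) 1)).
Qed.

Lemma is_derive_cir : is_derive (0 : R) 1 cir (0, 1).
Proof.
have H1 : is_derive (0 : R) 1 (@cos R) 0.
  by rewrite -[X in is_derive _ _ _ X]oppr0 -[X in - X]sin0; exact: is_derive_cos.
have H2 : is_derive (0 : R) 1 (@sin R) 1.
  by rewrite -[X in is_derive _ _ _ X]cos0; exact: is_derive_sin.
exact: (is_derive_pair H1 H2).
Qed.

Lemma ray_continuous : continuous ray.
Proof.
move=> t; apply: (@cvg_pair R R R (nbhs t) (nbhs (expR t)) (nbhs (0 : R))).
  exact: continuous_expR.
exact: cvg_cst.
Qed.

Lemma cir_continuous : continuous cir.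
Proof.
move=> t; apply: (@cvg_pair R R R (nbhs t) (nbhs (cos t)) (nbhs (sin t))).
  exact: continuous_cos.
exact: continuous_sin.
Qed.

End ComplexPlane.

(** * Slices of C^1 maps, the complex structure, and charts *)

Section PartialC1.
Context {R : realType} {U V W : normedModType R}.

Lemma near_slice (z : U) (x : V) (P : U * V -> Prop) :
  (\forall q \near (z, x), P q) -> \forall y \near x, P (z, y).
Proof.
move=> H.
have zc : (z, y) @[y --> x] --> (z, x).
  by apply: (@cvg_pair V U V (nbhs x) (nbhs z) (nbhs x)); [exact: cvg_cst|exact: cvg_id].
exact: (zc _ H).
Qed.

Lemma is_diff_slice (z : U) (y : V) : is_diff y (fun y => (z, y)) (fun v => (0, v)).
Proof. exact: (is_diff_pair (is_diff_cst z y) (is_diff_id y)). Qed.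

Lemma derive_slice (h : U * V -> W) z y v : differentiable h (z, y) ->
  differentiable (fun y => h (z, y)) y /\
  'D_v (fun y => h (z, y)) y = 'D_(0, v) h (z, y).
Proof.
move=> dh; have sd := is_diff_slice z y.
have dhz : differentiable (h \o (fun y => (z, y))) y by exact: differentiable_comp.
split=> //.
rewrite -[fun y => h (z, y)]/(h \o (fun y => (z, y))).
by rewrite deriveE// diff_comp//= diff_val deriveE.
Qed.

Lemma C1_slice (h : U * V -> W) z x :
  (\forall q \near (z, x), differentiable h q) ->
  (forall u, {for (z, x), continuous ('D_u h)}) ->
  (\forall y \near x, differentiable (fun y => h (z, y)) y) /\
  (forall v, {for x, continuous ('D_v (fun y => h (z, y)))}).
Proof.
move=> /near_slice dh ch; split.
  near=> y; have [] // := @derive_slice h z y 0.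
  by near: y.
move=> v.
have E : {near x, 'D_(0, v) h \o (fun y => (z, y)) =1 'D_v (fun y => h (z, y))}.
  near=> y; have [|_ ->] // := @derive_slice h z y v.
  by near: y.
rewrite /prop_for/= /continuous_at -(nbhs_singleton E) /=.
apply: cvg_trans; first exact: (near_eq_cvg E).
apply: (@cvg_comp _ _ _ (fun y => (z, y)) ('D_(0, v) h)); last exact: ch.
by apply: (@cvg_pair V U V (nbhs x) (nbhs z) (nbhs x)); [exact: cvg_cst|exact: cvg_id].
Unshelve. all: by end_near. Qed.

End PartialC1.

Section Chart.
Context {R : realType} {n : nat}.

Lemma multJ0 : multJ 0 = 0 :> Cspace R n.
Proof. by rewrite /multJ !linear0 row_mx0. Qed.

Lemma norm_multJ (v : Cspace R n) : `|multJ v| <= `|v|.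
Proof.
apply: rV_norm_le => // j; rewrite /multJ -(fintype.splitK j) /fintype.unsplit.
case: (fintype.split j) => k; rewrite ?row_mxEl ?row_mxEr !mxE ?normrN;
  exact: rV_coord_le.
Qed.

Lemma bform_anti m (B : 'M[R]_m) v w : B^T = - B -> bform B v w = - bform B w v.
Proof.
move=> BT; have -> : bform B v w = (v *m B *m w^T)^T 0 0 by rewrite [RHS]mxE.
by rewrite !trmx_mul trmxK BT /bform mulNmx mulmxN mulmxA [LHS]mxE.
Qed.

Lemma bform_le m (B : 'M[R]_m) v w :
  `|bform B v w| <= m%:R ^+ 2 * `|B| * `|v| * `|w|.
Proof.
have Bij i j : `|B i j| <= `|B|.
  rewrite [leRHS]/Num.Def.normr/= mx_normrE.
  exact: (le_bigmax _ (fun i : 'I_m * 'I_m => `|B i.1 i.2|) (i, j)).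
rewrite /bform mxE; apply: le_trans (ler_norm_sum _ _ _) _.
apply: (@le_trans _ _ (\sum_(j < m) m%:R * (`|v| * `|B| * `|w|))).
  apply: ler_sum => j _; rewrite normrM [w^T _ _]mxE mulrA ler_pM ?rV_coord_le//.
  rewrite mxE; apply: le_trans (ler_norm_sum _ _ _) _.
  apply: (@le_trans _ _ (\sum_(i < m) (`|v| * `|B|))).
    by apply: ler_sum => i _; rewrite normrM ler_pM// rV_coord_le.
  by rewrite sumr_const card_ord mulr_natl.
rewrite sumr_const card_ord -[leLHS]mulr_natl le_eqVlt; apply/orP; left; apply/eqP.
by ring.
Qed.

Context {M : topologicalType}.
Implicit Types c : chart R n M.

Lemma chart_img_fun c p : chart_dom c p -> chart_img c (c p).
Proof. by exists p. Qed.

Lemma chart_inv_dom c x : chart_img c x -> chart_dom c (chart_inv c x).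
Proof. by case=> p cp <-; rewrite chart_funK. Qed.

Lemma chart_invK c x : chart_img c x -> c (chart_inv c x) = x.
Proof. by case=> p cp <-; rewrite chart_funK. Qed.

Lemma near_chart_dom c p : chart_dom c p -> \forall q \near p, chart_dom c q.
Proof. by move=> cp; apply: open_nbhs_nbhs; split => //; exact: chart_dom_open. Qed.

Lemma near_chart_img c x : chart_img c x -> \forall y \near x, chart_img c y.
Proof. by move=> cx; apply: open_nbhs_nbhs; split => //; exact: chart_img_open. Qed.

Lemma near_chart_fun c p (P : Cspace R n -> Prop) : chart_dom c p ->
  (\forall x \near c p, P x) -> \forall q \near p, chart_dom c q /\ P (c q).
Proof.
move=> cp Px; near=> q; split; near: q; first exact: near_chart_dom.
exact: (chart_fun_continuous cp Px).
Unshelve. all: by end_near. Qed.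

Lemma near_chart_inv c p (P : M -> Prop) : chart_dom c p ->
  (\forall q \near p, P q) -> \forall x \near c p, P (chart_inv c x).
Proof.
move=> cp Pp; have := @chart_inv_continuous _ _ _ c _ (chart_img_fun cp).
by rewrite /prop_for /continuous_at/= chart_funK// => /(_ _ Pp).
Qed.

End Chart.

(** * One-parameter subgroups of the action, read in charts *)

Section ActionInCharts.
Context {R : realType} {n : nat} {M : topologicalType}.
Context {A : set (chart R n M)} {tau : R[i] -> M -> M}.
Context (htau : Cstar_holomorphic_action A tau).
Implicit Types (c d : chart R n M) (p q : M).

Definition act c d (q : R * R * Cspace R n) : Cspace R n :=
  d (tau (toC q.1) (chart_inv c q.2)).

Lemma toC_neq0 (z : R * R) : z != 0 -> toC z != 0.
Proof.
by apply: contra_neq; case: z => a b [-> ->].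
Qed.

Lemma tau_cvg (z : R * R) p : z != 0 ->
  tau (toC q.1) q.2 @[q --> (z, p)] --> tau (toC z) p.
Proof.
move=> /toC_neq0 z0; have tc := action_continuous htau (p := p) z0.
apply: (@cvg_comp _ _ _ (fun q : R * R * M => (toC q.1 : R[i]^o, q.2)) _ _ _ _ _ tc).
apply: (@cvg_pair (R * R * M)%type R[i]^o M (nbhs (z, p))
   (nbhs (toC z : R[i]^o)) (nbhs p)).
  by apply: (@cvg_comp _ _ _ fst toC); [exact: cvg_fst|exact: toC_continuous].
exact: cvg_snd.
Qed.

Lemma tau_near (z : R * R) p (P : M -> Prop) : z != 0 ->
  (\forall q \near tau (toC z) p, P q) ->
  \forall w \near z & q \near p, P (tau (toC w) q).
Proof. by move=> z0 Pq; have /(_ _ Pq) := tau_cvg (p := p) z0. Qed.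

Lemma act_domain_near c d p (z : R * R) : z != 0 -> chart_dom c p ->
  chart_dom d (tau (toC z) p) -> \forall q \near (z, c p),
  [/\ q.1 != 0, chart_img c q.2 & chart_dom d (tau (toC q.1) (chart_inv c q.2))].
Proof.
move=> z0 cp dp; near=> q; split; near: q.
- have : \forall w \near z, w != 0.
    apply/near_norm; exists `|z|; first by rewrite normr_gt0.
    by move=> w; apply: contraTneq => ->; rewrite sub0r normrN ltxx.
  by move=> wn0; exact: (cvg_fst wn0).
- have := near_chart_img (chart_img_fun cp) => wn0.
  exact: (cvg_snd wn0).
- have zp : (q.1, chart_inv c q.2) @[q --> (z, c p)] --> (z, p).
    apply: (@cvg_pair (R * R * Cspace R n)%type (R * R)%type M (nbhs (z, c p))
       (nbhs z) (nbhs p)); first exact: cvg_fst.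
    apply: (@cvg_comp _ _ _ snd (chart_inv c)); first exact: cvg_snd.
    by move=> P; exact: near_chart_inv.
  exact: (zp _ (tau_near z0 (near_chart_dom dp))).
Unshelve. all: by end_near. Qed.

Lemma act_C1 c d p (z : R * R) : A c -> A d -> z != 0 -> chart_dom c p ->
  chart_dom d (tau (toC z) p) ->
  (\forall q \near (z, c p), differentiable (act c d) q) /\
  (forall u, (\forall q \near (z, c p), differentiable ('D_u (act c d)) q) /\
     (forall v, {for (z, c p), continuous ('D_v ('D_u (act c d)))})).
Proof.
move=> Ac Ad z0 cp dp.
have near_dom := act_domain_near z0 cp dp.
have [sm _] := action_holomorphic htau Ac Ad.
have := sm 2 => -[d1 H]; split; first by apply: filterS near_dom => q /d1.
move=> u; have [d2 {}H] := H u; split; first by apply: filterS near_dom => q /d2.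
by move=> v; apply: H (nbhs_singleton near_dom).
Qed.

(** The velocity at time 0, in the chart [c], of [tau_(e t) p] when [e] is a curve
    in the plane with [e 0 = 1] and [e' 0 = w].  Below, [eta = inf_gen (1, 0)]
    generates [tau_(e^t)] and [xi = inf_gen (0, 1)] generates the rotations. *)
Definition inf_gen (w : R * R) c (x : Cspace R n) : Cspace R n :=
  'D_(w, 0) (act c c) ((1, 0), x).

Lemma one0_neq0 : ((1, 0) : R * R) != 0.
Proof. by apply/eqP => -[] /eqP; rewrite oner_eq0. Qed.

Lemma toC10 : toC ((1, 0) : R * R) = 1.
Proof. by []. Qed.

Lemma inf_gen_C1 w c p : A c -> chart_dom c p ->
  (\forall x \near c p, differentiable (inf_gen w c) x) /\
  (forall v, {for c p, continuous ('D_v (inf_gen w c))}).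
Proof.
move=> Ac cp; have [|_ /(_ (w, 0)) [dX cX]] := act_C1 Ac Ac one0_neq0 cp.
  by rewrite toC10 (action1 htau).
exact: C1_slice dX cX.
Qed.

(** The Cauchy-Riemann equations in the variable [z] of [tau z p], as [i = J 1]. *)
Lemma inf_gen_J c x : A c -> chart_img c x ->
  inf_gen (0, 1) c x = multJ (inf_gen (1, 0) c x).
Proof.
move=> Ac cx; have [_ CR] := action_holomorphic htau Ac Ac.
have := CR ((1, 0), x) ((1, 0), 0).
rewrite /multJ_prod/= oppr0 multJ0; apply; split=> //=.
  exact: one0_neq0.
by rewrite toC10 (action1 htau); exact: chart_inv_dom.
Qed.

Record one_parameter (e : R -> R * R) (w : R * R) : Prop := OneParameter {
  op_cont : continuous e;
  op_neq0 : forall t, e t != 0;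
  op_add : forall s t, toC (e (s + t)) = toC (e s) * toC (e t);
  op_0 : e 0 = (1, 0);
  op_derive : is_derive (0 : R) 1 e w
}.

Lemma one_parameter_ray : one_parameter ray (1, 0).
Proof.
split; [exact: ray_continuous| |exact: toC_rayD|by rewrite /ray expR0|exact: is_derive_ray].
by move=> t; apply/eqP => -[] /eqP; rewrite gt_eqF ?expR_gt0.
Qed.

Lemma one_parameter_cir : one_parameter cir (0, 1).
Proof.
split; [exact: cir_continuous| |exact: toC_cirD|by rewrite /cir cos0 sin0|exact: is_derive_cir].
move=> t; apply/eqP => -[c0 s0]; have := cos2Dsin2 t.
by rewrite c0 s0 expr0n/= addr0 => /esym/eqP; rewrite oner_eq0.
Qed.

Section OneParameter.
Context (e : R -> R * R) (w : R * R) (he : one_parameter e w).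

Lemma orbit_add s t p : tau (toC (e (s + t))) p = tau (toC (e s)) (tau (toC (e t)) p).
Proof. by rewrite (op_add he) (actionM htau)// toC_neq0// (op_neq0 he). Qed.

Lemma orbit_0 p : tau (toC (e 0)) p = p.
Proof. by rewrite (op_0 he) toC10 (action1 htau). Qed.

Lemma orbit_near p s (P : M -> Prop) :
  (\forall q \near tau (toC (e s)) p, P q) ->
  \forall t \near s & q \near p, P (tau (toC (e t)) q).
Proof.
move=> /(tau_near (op_neq0 he s)) H.
have ec : (e q.1, q.2) @[q --> (s, p)] --> (e s, p).
  apply: (@cvg_pair (R * M)%type (R * R)%type M (nbhs (s, p)) (nbhs (e s)) (nbhs p)).
    by apply: (@cvg_comp _ _ _ fst e); [exact: cvg_fst|exact: (op_cont he)].
  exact: cvg_snd.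
exact: (ec _ H).
Qed.

Lemma orbit_near1 p s (P : M -> Prop) :
  (\forall q \near tau (toC (e s)) p, P q) ->
  \forall t \near s, P (tau (toC (e t)) p).
Proof.
move=> /orbit_near H.
have tp : (t, p) @[t --> s] --> (s, p).
  by apply: (@cvg_pair R R M (nbhs s) (nbhs s) (nbhs p)); [exact: cvg_id|exact: cvg_cst].
exact: (tp _ H).
Qed.

Lemma orbit_near2 p s (P : M -> Prop) :
  (\forall q \near tau (toC (e s)) p, P q) ->
  \forall q \near p, P (tau (toC (e s)) q).
Proof.
move=> /orbit_near H.
have sq : (s, q) @[q --> p] --> (s, p).
  by apply: (@cvg_pair M R M (nbhs p) (nbhs s) (nbhs p)); [exact: cvg_cst|exact: cvg_id].
exact: (sq _ H).
Qed.

(** The group law reduces the derivative at time [s] to time 0 at the point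
    [tau_(e s) p]. *)
Lemma orbit_derive c p s : A c -> chart_dom c (tau (toC (e s)) p) ->
  is_derive s 1 (fun t => c (tau (toC (e t)) p))
    (inf_gen w c (c (tau (toC (e s)) p))).
Proof.
move=> Ac cp; set p' := tau (toC (e s)) p in cp *.
have -> : (fun t => c (tau (toC (e t)) p)) =
    act c c \o (fun t => (e (t - s), c p')).
  by apply/funext => t /=; rewrite /act/= chart_funK// /p' -orbit_add subrK.
have e1 : is_derive s 1 (fun t : R => e (t - s)) w.
  have s1 : is_derive s 1 (fun t : R => t - s) 1.
    by have := is_derive_shift s 1 (- s).
  have [de ew] := op_derive he.
  have := @is_derive_comp _ _ _ _ _ e _ s1.
  by rewrite subrr ew; apply; apply/derivable1_diffP.
have e2 := is_derive_pair e1 (is_derive_cst (c p') s 1).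
have := @is_derive_comp _ _ _ _ _ (act c c) _ e2.
rewrite /= subrr (op_0 he); apply.
have [|dX _] := act_C1 Ac Ac one0_neq0 cp; first by rewrite toC10 (action1 htau).
exact: nbhs_singleton dX.
Qed.

End OneParameter.
End ActionInCharts.

(** * The moment map along the orbits *)

Section HamiltonianAction.
Context {R : realType} {n : nat} {M : topologicalType}.
Context {A : set (chart R n M)} {om : chart R n M -> Cspace R n -> 'M[R]_(n + n)}.
Context {tau : R[i] -> M -> M} {phi : M -> R}.
Context (hM : compact_kahler A om) (htau : Cstar_holomorphic_action A tau).
Context (hphi : hamiltonian A om tau phi).
Implicit Types (c d : chart R n M) (p q : M).

Let hK : kahler_form A om := kahler_kahler_form hM.
Notation eta := (inf_gen (tau := tau) (1, 0)).
Notation xi := (inf_gen (tau := tau) (0, 1)).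

Lemma generatorE c x : A c -> chart_img c x -> generator tau c x = xi c x.
Proof.
move=> Ac cx; rewrite /generator derive1E.
have := orbit_derive htau one_parameter_cir (c := c) (p := chart_inv c x) (s := 0) Ac.
rewrite (orbit_0 htau one_parameter_cir) chart_invK//.
by move=> /(_ (chart_inv_dom cx)) [_ <-].
Qed.

Lemma moment_derive c x v : A c -> chart_img c x ->
  'D_v (phi \o chart_inv c) x = - bform (om c x) (multJ (eta c x)) v.
Proof.
move=> Ac cx; rewrite -(inf_gen_J htau)// -generatorE//.
by rewrite (moment_map hphi)// opprK.
Qed.

(** The moment map increases along its gradient [eta], at the rate given by the
    squared Kaehler norm of [eta]. *)
Lemma moment_derive_eta c x : A c -> chart_img c x ->
  'D_(eta c x) (phi \o chart_inv c) x = bform (om c x) (eta c x) (multJ (eta c x)).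
Proof.
move=> Ac cx; rewrite moment_derive// -bform_anti//.
exact: (kahler_alternating hK).
Qed.

Lemma moment_derive_eta_ge0 c x : A c -> chart_img c x ->
  0 <= 'D_(eta c x) (phi \o chart_inv c) x.
Proof.
move=> Ac cx; rewrite moment_derive_eta//.
have [->|e0] := eqVneq (eta c x) 0; last exact/ltW/(kahler_positive hK).
by rewrite /bform !mul0mx mxE.
Qed.

Lemma moment_derive_eta_eq0 c x : A c -> chart_img c x ->
  'D_(eta c x) (phi \o chart_inv c) x = 0 -> eta c x = 0.
Proof.
move=> Ac cx; rewrite moment_derive_eta//; apply: contra_eq => e0.
by rewrite gt_eqF// (kahler_positive hK).
Qed.

(** The form [om] is alternating and [iota_xi om = - d phi]. *)
Lemma moment_derive_xi c x : A c -> chart_img c x ->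
  'D_(xi c x) (phi \o chart_inv c) x = 0.
Proof.
move=> Ac cx; rewrite moment_derive// (inf_gen_J htau)//.
set v := multJ _; have := bform_anti v v (kahler_alternating hK Ac cx); lra.
Qed.

Lemma differentiable_moment c p : A c -> chart_dom c p ->
  differentiable (phi \o chart_inv c) (c p).
Proof.
move=> Ac cp; have [H _] := moment_smooth hphi Ac 1; apply: H.
exact: chart_img_fun.
Qed.

Lemma moment_continuous : continuous phi.
Proof.
move=> p; have [c Ac cp] := atlas_cover (kahler_atlas hM) p.
have phic := differentiable_continuous (differentiable_moment Ac cp).
move=> P Pp; have Pc : \forall x \near c p, P (phi (chart_inv c x)).
  by apply: phic; rewrite /= chart_funK.
have Pq := near_chart_fun cp Pc.
by apply: (filterS _ Pq) => q [cq]; rewrite /= chart_funK.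
Qed.

Lemma moment_orbit_derive e w c p (s : R) : one_parameter e w -> A c ->
  chart_dom c (tau (toC (e s)) p) ->
  is_derive s 1 (fun t => phi (tau (toC (e t)) p))
    ('D_(inf_gen (tau := tau) w c (c (tau (toC (e s)) p))) (phi \o chart_inv c)
       (c (tau (toC (e s)) p))).
Proof.
move=> he Ac cs.
have := @is_derive_comp _ _ _ _ _ (phi \o chart_inv c) _
  (orbit_derive htau he (p := p) Ac cs) (differentiable_moment Ac cs).
apply: near_eq_is_derive.
apply: filterS (orbit_near1 htau he (near_chart_dom cs)) => t ct /=.
by rewrite chart_funK.
Qed.

Lemma moment_cir t p : phi (tau (toC (cir t)) p) = phi p.
Proof.
rewrite -[in RHS](orbit_0 htau one_parameter_cir p).
apply: (is_derive_0_is_cst (f := fun t => phi (tau (toC (cir t)) p))) => s.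
have [c Ac cs] := atlas_cover (kahler_atlas hM) (tau (toC (cir s)) p).
have := moment_orbit_derive one_parameter_cir Ac cs.
by rewrite moment_derive_xi//; exact: chart_img_fun.
Qed.

Lemma moment_ray_le s t p : s <= t ->
  phi (tau (toC (ray s)) p) <= phi (tau (toC (ray t)) p).
Proof.
move=> st; pose f t := phi (tau (toC (ray t)) p).
have df (u : R) : exists2 l : R, 0 <= l & is_derive u 1 f l.
  have [c Ac cs] := atlas_cover (kahler_atlas hM) (tau (toC (ray u)) p).
  have := moment_orbit_derive one_parameter_ray Ac cs.
  set l := 'D__ _ _ => dl; exists l => //.
  by apply: moment_derive_eta_ge0 => //; exact: chart_img_fun.
apply: (@ger0_derive1_ndecr R f s t) => //.
- by move=> u _; have [l _ []] := df u.
- by move=> u _; have [l l0 [_ H]] := df u; rewrite derive1E H.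
- apply: derivable_within_continuous => u _.
  by have [l _ []] := df u.
Qed.

Lemma inf_gen_lipschitz w c p : A c -> chart_dom c p ->
  exists2 L : R, 0 <= L & exists2 r : R, 0 < r & forall a b,
    `|a - c p| < r -> `|b - c p| < r ->
    `|inf_gen (tau := tau) w c a - inf_gen (tau := tau) w c b| <= L * `|a - b|.
Proof. by move=> Ac cp; have [dX cX] := inf_gen_C1 htau w Ac cp; exact: C1_lipschitz. Qed.

(** [short_time_flow] for the arc of the circle orbit of [q] that starts at the
    angle [t0]. *)
Lemma short_arc c p L r t0 h q : A c -> 0 <= L ->
  (forall a b, `|a - c p| < r -> `|b - c p| < r ->
    `|xi c a - xi c b| <= L * `|a - b|) ->
  0 <= h -> h * L <= 4^-1 ->
  (forall t : R, 0 <= t <= h -> chart_dom c (tau (toC (cir (t0 + t))) q) /\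
     `|c (tau (toC (cir (t0 + t))) q) - c p| < r) ->
  let q' := tau (toC (cir t0)) q in
  (forall t : R, 0 <= t <= h ->
    `|c (tau (toC (cir t)) q') - c q'| <= 2 * h * `|xi c (c q')|) /\
  `|c (tau (toC (cir h)) q') - c q' - h *: xi c (c q')| <=
     2 * h ^+ 2 * L * `|xi c (c q')|.
Proof.
move=> Ac L0 XL h0 hL qB q'.
have qE t : tau (toC (cir t)) q' = tau (toC (cir (t0 + t))) q.
  by rewrite /q' -(orbit_add htau one_parameter_cir) addrC.
have q'0 : tau (toC (cir 0)) q' = q' by exact: (orbit_0 htau one_parameter_cir).
have h0h : is_true ((0 : R) <= 0 <= h) by apply/andP; split.
have := @short_time_flow R _ (xi c) (fun t => c (tau (toC (cir t)) q')) L h h0 L0 hL.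
rewrite q'0; apply => t th.
- by apply: (orbit_derive htau one_parameter_cir) => //; rewrite qE; have [] := qB t th.
- rewrite -[in xi c (c q')]q'0 -[X in `|_ - c X|]q'0; apply: XL.
    by rewrite qE; have [] := qB t th.
  by rewrite qE; have [] := qB 0 h0h.
Qed.

Lemma fixed_cir_of_small_times p h : 0 < h ->
  (forall t : R, 0 <= t <= h -> tau (toC (cir t)) p = p) ->
  forall t, tau (toC (cir t)) p = p.
Proof.
move=> h0 hp.
have pos (t : R) : 0 <= t -> tau (toC (cir t)) p = p.
  move=> t0; pose N := Num.bound (t / h).
  have N0 : 0 < N.+1%:R :> R by [].
  have tN : 0 <= t / N.+1%:R <= h.
    rewrite divr_ge0//= ler_pdivrMr// mulrC -ler_pdivrMr//.
    apply: (@le_trans _ _ N%:R); last by rewrite ler_nat.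
    by rewrite ltW// archi_boundP// divr_ge0// ltW.
  have : forall j, tau (toC (cir (t / N.+1%:R *+ j))) p = p.
    elim=> [|j IH]; first by rewrite mulr0n (orbit_0 htau one_parameter_cir).
    by rewrite mulrS (orbit_add htau one_parameter_cir) IH hp.
  by move=> /(_ N.+1); rewrite -mulr_natr divfK// gt_eqF.
move=> t; have [t0|t0] := leP 0 t; first exact: pos.
rewrite -{1}(pos (- t)) ?oppr_ge0 ?ltW//.
by rewrite -(orbit_add htau one_parameter_cir) subrr (orbit_0 htau one_parameter_cir).
Qed.

(** Where the velocity vanishes the orbit is locally constant, by uniqueness of
    integral curves. *)
Lemma zero_fixed c p : A c -> chart_dom c p -> eta c (c p) = 0 ->
  forall t, tau (toC (cir t)) p = p.
Proof.
move=> Ac cp e0.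
have x0 : xi c (c p) = 0.
  by rewrite (inf_gen_J htau)// ?e0 ?multJ0//; exact: chart_img_fun.
have [L L0 [r r0 XL]] := inf_gen_lipschitz (0, 1) Ac cp.
have near0 : \forall t \near (0 : R), chart_dom c (tau (toC (cir t)) p) /\
    `|c (tau (toC (cir t)) p) - c p| < r.
  have H : \forall q \near tau (toC (cir 0)) p, chart_dom c q /\ `|c q - c p| < r.
    rewrite (orbit_0 htau one_parameter_cir).
    have Pr : \forall x \near c p, `|x - c p| < r by apply/near_norm; exists r.
    exact: (near_chart_fun cp Pr).
  exact: (orbit_near1 htau one_parameter_cir H).
have /near_norm [s s0 sP] := near0.
pose h := Num.min (s / 2) (4 * (L + 1))^-1.
have L1 : 0 < L + 1 by rewrite ltr_wpDl.
have h0 : 0 < h by rewrite lt_min divr_gt0//= invr_gt0 mulr_gt0.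
have hL : h * L <= 4^-1.
  apply: (@le_trans _ _ ((4 * (L + 1))^-1 * L)).
    by rewrite ler_wpM2r// ge_min lexx orbT.
  by rewrite invfM -mulrA ler_piMr// ?invr_ge0// ler_pdivrMl// mulr1 lerDl.
have hs : h < s.
  by rewrite gt_min ltr_pdivrMr// ltr_pMr// ltr1n.
apply: (@fixed_cir_of_small_times p h) => // t th.
have qB (u : R) : 0 <= u <= h -> chart_dom c (tau (toC (cir (0 + u))) p) /\
     `|c (tau (toC (cir (0 + u))) p) - c p| < r.
  move=> /andP[u0 uh]; rewrite add0r; apply: sP.
  by rewrite subr0 ger0_norm// (le_lt_trans uh).
have := short_arc Ac L0 XL (ltW h0) hL qB.
rewrite /= (orbit_0 htau one_parameter_cir) => -[/(_ t th) + _].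
rewrite x0 normr0 mulr0 normr_le0 subr_eq0 => /eqP ct.
have [td _] := qB t th; rewrite add0r in td.
by rewrite -(chart_funK td) ct chart_funK.
Qed.

End HamiltonianAction.

(** * Limit points of an orbit at z = 0, and averages over circles *)

(** The condition [Q] is kept on the times at which [y] comes near [p]; it carries
    the failure of a property along a sequence of times to the limit point. *)
Lemma accumulation (R : realType) (T : topologicalType) (y : R -> T)
    (Q : R -> Prop) (K : set T) :
  compact K -> (forall a, exists t, [/\ t < a, Q t & K (y t)]) ->
  exists2 p, K p & forall a U, nbhs p U -> exists t, [/\ t < a, Q t & U (y t)].
Proof.
move=> cK QK.
pose B (a : R) : set T := [set y t | t in [set t | [/\ t < a, Q t & K (y t)]]].
have FF : ProperFilter (filter_from [set: R] B).
  apply: filter_from_proper; last first.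
    by move=> a _; have [t tP] := QK a; exists (y t), t.
  apply: filter_from_filter; first by exists 0.
  move=> a b _ _; exists (Num.min a b) => // _ [t [tab Qt Kt] <-].
  by move: tab; rewrite lt_min => /andP[ta tb]; split; exists t.
have [|p [Kp clp]] := cK _ FF.
  by exists 0 => // _ [t [_ _ Kt] <-].
exists p => // a U Up.
have [|_ [[t [ta Qt _] <-] Ut]] := clp (B a) U _ Up; first by exists a.
by exists t.
Qed.

Section LimitPoints.
Context {R : realType} {n : nat} {M : topologicalType}.
Context {A : set (chart R n M)} {om : chart R n M -> Cspace R n -> 'M[R]_(n + n)}.
Context {tau : R[i] -> M -> M} {phi : M -> R}.
Context (hM : compact_kahler A om) (htau : Cstar_holomorphic_action A tau).
Context (hphi : hamiltonian A om tau phi).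
Implicit Types (c d : chart R n M) (p q : M).

Notation eta := (inf_gen (tau := tau) (1, 0)).
Notation xi := (inf_gen (tau := tau) (0, 1)).
Notation rayt q t := (tau (toC (ray t)) q).
Notation cirt q t := (tau (toC (cir t)) q).

(** The limit points, as [t] tends to [-oo], of [tau_(e^t) q]. *)
Definition alpha_limit q p := forall (a : R) (U : set M), nbhs p U ->
  exists2 t, t < a & U (rayt q t).

Lemma alpha_limit_exists q : exists p, alpha_limit q p.
Proof.
have [|p _ pP] := @accumulation R M (fun t => rayt q t) (fun=> True) setT (kahler_compact hM).
  by move=> a; exists (a - 1); split => //; rewrite gtrBl.
by exists p => a U Up; have [t [ta _ Ut]] := pP a U Up; exists t.
Qed.

(** [phi] is nondecreasing in [t], so it stays above its limit at [-oo]. *)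
Lemma moment_ge_alpha_limit q p t : alpha_limit q p -> phi p <= phi (rayt q t).
Proof.
move=> qp; apply/ler_addgt0Pr => e e0.
have pc : phi m @[m --> p] --> phi p by exact: (moment_continuous hM hphi).
have pe : \forall m \near p, `|phi p - phi m| < e.
  exact: ((cvgrPdist_lt _ _).1 pc e e0).
have [s st] := qp t _ pe; rewrite ltr_norml => /andP[_ se].
have sle := moment_ray_le hM htau hphi q (ltW st).
lra.
Qed.

Lemma alpha_limit_level q p p' : alpha_limit q p -> alpha_limit q p' -> phi p <= phi p'.
Proof.
move=> qp qp'; apply/ler_addgt0Pr => e e0.
have pc : phi m @[m --> p'] --> phi p' by exact: (moment_continuous hM hphi).
have pe : \forall m \near p', `|phi p' - phi m| < e.
  exact: ((cvgrPdist_lt _ _).1 pc e e0).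
have [s _] := qp' 0 _ pe; rewrite ltr_norml => /andP[se _].
have := moment_ge_alpha_limit s qp; lra.
Qed.

Lemma alpha_limit_ray q p s : alpha_limit q p -> alpha_limit q (rayt p s).
Proof.
move=> qp a U Us.
have pU := orbit_near2 htau one_parameter_ray Us.
have [t ta Ut] := qp (a - s) _ pU.
exists (s + t); first by rewrite addrC -ltrBrDr.
by rewrite (orbit_add htau one_parameter_ray).
Qed.

(** The limit set is invariant under [tau_(e^s)] and [phi] takes only one value on
    it, so [phi] is constant on the orbit of [p] and its derivative
    [om (eta, J eta)] vanishes at [p]. *)
Lemma alpha_limit_critical q p c : alpha_limit q p -> A c -> chart_dom c p ->
  eta c (c p) = 0.
Proof.
move=> qp Ac cp.
apply: (moment_derive_eta_eq0 hM htau hphi) => //; first exact: chart_img_fun.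
have := moment_orbit_derive htau hphi (p := p) (s := 0) one_parameter_ray Ac.
rewrite (orbit_0 htau one_parameter_ray) => /(_ cp) [_ <-].
have -> : (fun t => phi (rayt p t)) = cst (phi p).
  apply/funext => t /=; apply/eqP; rewrite eq_le.
  by rewrite !(alpha_limit_level (q := q))//; exact: alpha_limit_ray.
by rewrite derive_val.
Qed.

Lemma alpha_limit_fixed q p t : alpha_limit q p -> cirt p t = p.
Proof.
move=> qp; have [c Ac cp] := atlas_cover (kahler_atlas hM) p.
exact: (zero_fixed htau Ac cp (alpha_limit_critical qp Ac cp)).
Qed.

(** Tube lemma, for the compact interval of angles. *)
Lemma circle_tube p (U : set M) : (forall t, cirt p t = p) -> nbhs p U ->
  \forall m \near p, forall t, 0 <= t <= pi *+ 2 -> U (cirt m t).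
Proof.
move=> pfix Up.
have /compact_near_coveringP tube := @segment_compact R 0 (pi *+ 2).
apply: filterS (tube M (nbhs p) (fun m t => U (cirt m t)) _ _) => [m mU t t2pi|t _].
  by apply: mU; rewrite /= in_itv.
by have := orbit_near htau one_parameter_cir (s := t) (p := p) (P := U); rewrite pfix; apply.
Qed.

Lemma ray_cir_comm q s t : rayt (cirt q t) s = cirt (rayt q s) t.
Proof.
by rewrite -!(actionM htau) ?toC_ray_neq0 ?toC_cir_neq0// mulrC.
Qed.

Lemma multJK (v : Cspace R n) : multJ (multJ v) = - v.
Proof.
by rewrite /multJ row_mxKl row_mxKr -[in RHS](hsubmxK v) opp_row_mx.
Qed.

Lemma multJ_sum (I : Type) (s : seq I) (f : I -> Cspace R n) :
  multJ (\sum_(i <- s) f i) = \sum_(i <- s) multJ (f i).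
Proof.
have multJD (u v : Cspace R n) : multJ (u + v) = multJ u + multJ v.
  by rewrite /multJ !linearD/= add_row_mx.
exact: (big_morph _ multJD multJ0).
Qed.

(** Let [x_j] be the coordinates of the rotation of [tau_(e^t) q] by [2 pi j / N].
    Since [xi = J eta], the derivative in [t] of the average of the [x_j] has the
    norm of the average of the [xi (x_j)].  Up to an error [O(h ^ 2)], with
    [h = 2 pi / N], [h * xi (x_j)] is [x_(j + 1) - x_j], and these increments sum up
    to 0 around the circle.  So the average moves at a speed [O(1 / N)]; at both
    ends it is within [k] of the point itself. *)
Lemma mean_displacement c p q (L r k t1 t2 : R) : A c -> chart_dom c p ->
  eta c (c p) = 0 -> 0 <= L -> 0 < r ->
  (forall a b, `|a - c p| < r -> `|b - c p| < r ->
    `|xi c a - xi c b| <= L * `|a - b|) ->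
  t1 <= t2 ->
  (forall t s, t1 <= t <= t2 -> 0 <= s <= pi *+ 2 ->
     [/\ chart_dom c (cirt (rayt q t) s), `|c (cirt (rayt q t) s) - c p| < r &
      `|c (cirt (rayt q t) s) - c (rayt q t)| <= k]) ->
  `|c (rayt q t2) - c (rayt q t1)| <= 2 * k.
Proof.
move=> Ac cp e0 L0 r0 XL t12 loops.
pose C := 2 * (pi *+ 2) * L * (L * r) * (t2 - t1).
have pi0 : 0 < (pi *+ 2 : R) by rewrite mulrn_wgt0// pi_gt0.
have C0 : 0 <= C by rewrite !mulr_ge0 ?subr_ge0 ?(ltW pi0) ?(ltW r0).
suff H N : (pi *+ 2) * L * 4 <= N.+1%:R ->
    `|c (rayt q t2) - c (rayt q t1)| <= 2 * k + C / N.+1%:R.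
  apply/ler_addgt0Pr => e e1.
  pose N := Num.bound (C / e + (pi *+ 2) * L * 4).
  have bN : C / e + (pi *+ 2) * L * 4 <= N.+1%:R.
    apply: (@le_trans _ _ N%:R); last by rewrite ler_nat.
    apply: ltW; apply: archi_boundP; apply: addr_ge0; first by rewrite divr_ge0 // ltW.
    by rewrite !mulr_ge0 // ltW.
  apply: le_trans (H N _) _.
    by apply: le_trans bN; rewrite lerDr divr_ge0// ltW.
  rewrite lerD2l ler_pdivrMr// mulrC -ler_pdivrMr//.
  by apply: le_trans bN; rewrite lerDl !mulr_ge0// ltW.
move=> NL; pose h : R := (pi *+ 2) / N.+1%:R.
have h0 : 0 < h by rewrite divr_gt0.
have hN : h * N.+1%:R = pi *+ 2 by rewrite divfK.
have hL : h * L <= 4^-1.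
  by rewrite /h mulrAC ler_pdivrMr// ler_pdivlMl// mulrC.
have hE : h = (pi *+ 2) / N.+1%:R by [].
clearbody h.
pose x j t := c (rayt (cirt q (h * j%:R)) t).
have xE j t : x j t = c (cirt (rayt q t) (h * j%:R)) by rewrite /x ray_cir_comm.
have hj j : (j <= N.+1)%N -> 0 <= h * j%:R <= pi *+ 2.
  move=> jN; apply/andP; split; first by rewrite mulr_ge0 // ltW.
  by rewrite -hN ler_wpM2l ?(ltW h0) // ler_nat.
have xdom j t : (j <= N.+1)%N -> t1 <= t <= t2 ->
    chart_dom c (rayt (cirt q (h * j%:R)) t).
  by move=> jN tt; rewrite ray_cir_comm; have [] := loops t _ tt (hj j jN).
have xball j t : (j <= N.+1)%N -> t1 <= t <= t2 -> `|x j t - c p| < r.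
  by move=> jN tt; rewrite xE; have [] := loops t _ tt (hj j jN).
have xi0 : xi c (c p) = 0.
  by rewrite (inf_gen_J htau)// ?e0 ?multJ0//; exact: chart_img_fun.
have xi_le a : `|a - c p| < r -> `|xi c a| <= L * r.
  move=> ar; rewrite -[xi c a]subr0 -xi0; apply: le_trans (XL _ _ ar _) _.
    by rewrite subrr normr0.
  by rewrite ler_wpM2l// ltW.
pose mean t := N.+1%:R^-1 *: \sum_(j < N.+1) x j t.
pose dmean t := N.+1%:R^-1 *: \sum_(j < N.+1) eta c (x j t).
have dmeanP (t : R) : t1 <= t <= t2 -> is_derive t 1 mean (dmean t).
  move=> tt.
  have -> : mean = N.+1%:R^-1 \*: (\sum_(j < N.+1) x j).
    by apply/funext => u; rewrite /mean fct_sumE.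
  apply: is_deriveZ; apply: is_derive_sum => j.
  by apply: (orbit_derive htau one_parameter_ray) => //; exact: xdom (ltnW (ltn_ord j)) tt.
have sum_le (t : R) : t1 <= t <= t2 ->
    `|\sum_(j < N.+1) xi c (x j t)| <= N.+1%:R * (2 * h * L * (L * r)).
  move=> tt.
  have arc (j : 'I_N.+1) : `|x j.+1 t - x j t - h *: xi c (x j t)| <=
      2 * h ^+ 2 * L * (L * r).
    have jN := ltnW (ltn_ord j).
    have qB s : 0 <= s <= h -> chart_dom c (cirt (rayt q t) (h * j%:R + s)) /\
        `|c (cirt (rayt q t) (h * j%:R + s)) - c p| < r.
      move=> /andP[s0 sh].
      have jh : is_true (0 <= h * j%:R + s <= pi *+ 2).
        apply/andP; split; first by rewrite addr_ge0// mulr_ge0// ltW.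
        have jN1 : h * j.+1%:R <= pi *+ 2 by have /andP[] := hj j.+1 (ltn_ord j).
        by apply: le_trans jN1; rewrite -natr1 mulrDr mulr1 lerD2l.
      by have [? ? _] := loops t _ tt jh.
    have [_] := short_arc htau Ac L0 XL (ltW h0) hL qB.
    rewrite /= -(orbit_add htau one_parameter_cir) -xE.
    have -> : h + h * j%:R = h * j.+1%:R by rewrite -natr1 mulrDr mulr1 addrC.
    rewrite -xE => /le_trans; apply.
    rewrite ler_wpM2l ?mulr_ge0 ?sqr_ge0 ?(ltW h0)//.
    exact: xi_le (xball _ _ jN tt).
  have tele : \sum_(j < N.+1) (x j.+1 t - x j t) = 0.
    rewrite -(big_mkord xpredT (fun j => x j.+1 t - x j t)) telescope_sumr//.
    rewrite !xE hN mulr0 (orbit_0 htau one_parameter_cir).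
    have -> : toC (cir (pi *+ 2 : R)) = 1 by rewrite /toC /= cos2pi sin2pi.
    by rewrite (action1 htau) subrr.
  have hs : h *: \sum_(j < N.+1) xi c (x j t) =
      - \sum_(j < N.+1) (x j.+1 t - x j t - h *: xi c (x j t)).
    by rewrite sumrB tele sub0r opprK scaler_sumr.
  rewrite -(ler_pM2l h0) -[X in X * _](ger0_norm (ltW h0)) -normrZ hs normrN.
  apply: le_trans (ler_norm_sum _ _ _) _.
  apply: le_trans (ler_sum _ (fun j _ => arc j)) _.
  rewrite sumr_const card_ord -[leLHS]mulr_natl.
  by rewrite le_eqVlt; apply/orP; left; apply/eqP; ring.
have dmean_le (t : R) : t1 <= t <= t2 -> `|dmean t| <= 2 * h * L * (L * r).
  move=> tt; rewrite /dmean normrZ ger0_norm ?invr_ge0// ler_pdivrMl//.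
  apply: le_trans _ (sum_le t tt).
  rewrite -[leLHS]normrN -multJK; apply: le_trans (norm_multJ _) _.
  rewrite multJ_sum le_eqVlt; apply/orP; left; apply/eqP; congr (`|_|).
  apply: eq_bigr => j _; rewrite (inf_gen_J htau)//.
  by apply: chart_img_fun; exact: xdom (ltnW (ltn_ord j)) tt.
have mean_near t : t1 <= t <= t2 -> `|mean t - c (rayt q t)| <= k.
  move=> tt.
  have -> : mean t - c (rayt q t) =
      N.+1%:R^-1 *: \sum_(j < N.+1) (x j t - c (rayt q t)).
    have avgc (v : Cspace R n) : N.+1%:R^-1 *: (v *+ N.+1) = v.
      by rewrite -[v *+ _]scaler_nat scalerA mulVf ?scale1r.
    by rewrite sumrB sumr_const card_ord scalerBr avgc.
  rewrite normrZ ger0_norm ?invr_ge0// ler_pdivrMl//.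
  apply: le_trans (ler_norm_sum _ _ _) _.
  apply: (@le_trans _ _ (\sum_(j < N.+1) k)).
    apply: ler_sum => j _; rewrite xE.
    by have [] := loops t _ tt (hj j (ltnW (ltn_ord j))).
  by rewrite sumr_const card_ord mulr_natl.
have m12 := mvt_norm t12 dmeanP dmean_le.
have t11 : is_true (t1 <= t1 <= t2) by rewrite lexx.
have t22 : is_true (t1 <= t2 <= t2) by rewrite lexx t12.
have m1 := mean_near t1 t11; have m2 := mean_near t2 t22.
have CE : C / N.+1%:R = 2 * h * L * (L * r) * (t2 - t1) by rewrite /C hE; ring.
have -> : c (rayt q t2) - c (rayt q t1) =
    (mean t2 - mean t1) - (mean t2 - c (rayt q t2)) + (mean t1 - c (rayt q t1)).
  by rewrite addrAC subrKA opprB addrC subrKA.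
apply: le_trans (ler_normD _ _) _; rewrite CE.
have := ler_normB (mean t2 - mean t1) (mean t2 - c (rayt q t2)).
lra.
Qed.

End LimitPoints.

(** * Convergence of the orbits at z = 0 *)

Section Convergence.
Context {R : realType} {n : nat} {M : topologicalType}.
Context {A : set (chart R n M)} {om : chart R n M -> Cspace R n -> 'M[R]_(n + n)}.
Context {tau : R[i] -> M -> M} {phi : M -> R}.
Context (hM : compact_kahler A om) (htau : Cstar_holomorphic_action A tau).
Context (hphi : hamiltonian A om tau phi).
Implicit Types (c d : chart R n M) (p q : M).

Notation eta := (inf_gen (tau := tau) (1, 0)).
Notation xi := (inf_gen (tau := tau) (0, 1)).
Notation rayt q t := (tau (toC (ray t)) q).
Notation cirt q t := (tau (toC (cir t)) q).
Notation alpha_limit := (alpha_limit (tau := tau)).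

Definition chart_ball c p (e : R) : set M :=
  [set m | chart_dom c m /\ `|c m - c p| <= e].

Lemma compact_chart_ball c p e : chart_dom c p ->
  (forall x, `|x - c p| <= e -> chart_img c x) -> compact (chart_ball c p e).
Proof.
move=> cp eimg.
have -> : chart_ball c p e = chart_inv c @` [set x | `|x - c p| <= e].
  apply/seteqP; split=> [m [cm me]|_ [x xe <-]].
    by exists (c m) => //; exact: chart_funK.
  split; first exact/chart_inv_dom/eimg.
  by rewrite chart_invK//; exact: eimg.
apply: continuous_compact.
  apply: continuous_in_subspaceT => x /[!inE] xe.
  exact/chart_inv_continuous/eimg.
have -> : [set x | `|x - c p| <= e] = closed_ball_ (fun x => `|x|) (c p) e.
  by apply/seteqP; split=> x /=; rewrite distrC.
apply: bounded_closed_compact; last exact: closed_closed_ball_.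
exists (`|c p| + e); split; first exact: num_real.
move=> y ye x /= xe; apply: le_trans (ltW ye).
rewrite -(subrK (c p) x) -normrN opprD opprB; apply: le_trans (ler_normD _ _) _.
by rewrite normrN addrC lerD2l.
Qed.

(** Otherwise the circles through some points of the orbit, with [t] arbitrarily
    close to [-oo], would not be small.  These points would accumulate at a limit
    point of the orbit, which is fixed by the circle: a contradiction with
    [circle_tube]. *)
Lemma small_loops q c p e (k : R) : compact (chart_ball c p e) -> 0 < k ->
  exists T, forall t s, t < T -> chart_ball c p e (rayt q t) ->
    0 <= s <= pi *+ 2 ->
    chart_dom c (cirt (rayt q t) s) /\ `|c (cirt (rayt q t) s) - c (rayt q t)| < k.
Proof.
move=> cK k0; apply/not_existsP => H.
pose Q t := ~ forall s, 0 <= s <= pi *+ 2 ->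
    chart_dom c (cirt (rayt q t) s) /\ `|c (cirt (rayt q t) s) - c (rayt q t)| < k.
have [|p' [cp' _] p'P] := @accumulation R M (fun t => rayt q t) Q _ cK.
  move=> a; have /existsNP[t /existsNP[s /not_implyP[ta /not_implyP[Kt ts]]]] := H a.
  exists t; split=> // Qt; apply: ts; exact: Qt.
have qp' : alpha_limit q p' by move=> a U Up; have [t [ta _ Ut]] := p'P a U Up; exists t.
have p'fix t : cirt p' t = p' by exact: (alpha_limit_fixed hM htau hphi t qp').
have near' : \forall m \near p', chart_dom c m /\ `|c m - c p'| < k / 2.
  have Pr : \forall x \near c p', `|x - c p'| < k / 2.
    apply/near_norm; exists (k / 2); last by [].
    by rewrite divr_gt0.
  exact: (near_chart_fun cp' Pr).
have tube := circle_tube htau p'fix near'.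
have [t [_ Qt Ut]] := p'P 0 _ tube.
apply: Qt => s s2pi; have [ds sk] := Ut s s2pi; split => //.
have s00 : is_true ((0 : R) <= 0 <= @pi R *+ 2).
  by apply/andP; split => //; apply: mulrn_wge0; exact: pi_ge0.
have [_] := Ut 0 s00; rewrite (orbit_0 htau one_parameter_cir) => k2.
rewrite -(subrKA (c p')); apply: le_lt_trans (ler_normD _ _) _.
by rewrite (splitr k) ltrD// distrC.
Qed.

(** Suppose that the orbit, followed backwards from a time [t0] at which it is very
    close to [p], leaves the ball of radius [e1], and let [s] be the time of the
    exit.  On [s, t0] its circles are small and stay in the chart, so by
    [mean_displacement] its positions at the times [s] and [t0] are close: it is
    still inside the ball at the time [s]. *)
Lemma alpha_limit_trap q p c (e : R) : A c -> alpha_limit q p -> chart_dom c p -> 0 < e ->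
  exists T, forall t s, t < T -> 0 <= s <= pi *+ 2 ->
    chart_dom c (cirt (rayt q t) s) /\ `|c (cirt (rayt q t) s) - c p| < e.
Proof.
move=> Ac qp cp e0.
have eta0 := alpha_limit_critical hM htau hphi qp Ac cp.
have [L L0 [r r0 XL]] := inf_gen_lipschitz htau (0, 1) Ac cp.
have [r1 r10 r1P] := (near_norm _ _).1 (near_chart_img (chart_img_fun cp)).
(* [e1] is halved so that loops of size [e1 / 8] based in the closed ball of
   radius [e1] stay within [e] and [r] of [c p] *)
pose e1 := Num.min e (Num.min r r1) / 2.
have min0 : 0 < Num.min e (Num.min r r1) by rewrite !lt_min e0 r0.
have [e1e e1r e1r1] : [/\ e1 + e1 <= e, e1 + e1 <= r & e1 + e1 <= r1].
  by rewrite /e1 -splitr !ge_min !lexx !orbT.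
have e10 : 0 < e1 by rewrite divr_gt0.
clearbody e1.
have Kc : compact (chart_ball c p e1).
  apply: compact_chart_ball => // x xe1; apply: r1P; apply: le_lt_trans xe1 _.
  lra.
have Kclosed : closed (chart_ball c p e1).
  exact: compact_closed (kahler_hausdorff hM) Kc.
have k0 : 0 < e1 / 8 by rewrite divr_gt0.
have [T TP] := small_loops q Kc k0.
have open_ball m : chart_dom c m -> `|c m - c p| < e1 ->
    \forall m' \near m, chart_dom c m' /\ `|c m' - c p| < e1.
  move=> cm me; apply: (near_chart_fun (P := fun x => `|x - c p| < e1)) => //.
  apply/near_norm; exists (e1 - `|c m - c p|); first by rewrite subr_gt0.
  move=> x xe; rewrite -(subrKA (c m)); apply: le_lt_trans (ler_normD _ _) _.
  by rewrite -ltrBrDr.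
pose U t := chart_dom c (rayt q t) /\ `|c (rayt q t) - c p| < e1.
have Uopen t : U t -> \forall s \near t, U s.
  by move=> [dt Ut]; exact: (orbit_near1 htau one_parameter_ray (open_ball _ dt Ut)).
have near8 : \forall m \near p, chart_dom c m /\ `|c m - c p| < e1 / 8.
  apply: (near_chart_fun (P := fun x => `|x - c p| < e1 / 8)) => //.
  by apply/near_norm; exists (e1 / 8).
have [t0 t0T [dt0 t0e]] := qp T _ near8.
have Ut0 : U t0 by split => //; lra.
suff trap t : t <= t0 -> U t.
  exists t0 => t s tt0 s2pi; have [dt te] := trap t (ltW tt0).
  have [||ds se] := TP t s _ _ s2pi.
  - exact: lt_trans tt0 t0T.
  - by split => //; exact: ltW.
  split => //; rewrite -(subrKA (c (rayt q t))).
  apply: le_lt_trans (ler_normD _ _) _; lra.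
move=> tt0; apply: contrapT => Ut.
(* the last time before [t0] at which the orbit is out of the open ball *)
pose Bad := [set u | u <= t0 /\ ~ U u].
have Bad0 : Bad !=set0 by exists t.
have Badub : ubound Bad t0 by move=> u [].
have Badsup : has_sup Bad by split => //; exists t0.
pose s := sup Bad.
have st0 : s <= t0 by exact: ge_sup.
have after u : s < u -> u <= t0 -> U u.
  move=> su ut0; apply: contrapT => nU.
  have : u <= s by apply: ub_le_sup; [exact: Badsup.2|split].
  by rewrite leNgt su.
have nUs : ~ U s.
  move=> Us; have [d d0 dP] := (near_norm _ _).1 (Uopen s Us).
  have [u [ut0 nU] ud] := sup_adherent d0 Badsup.
  have us : u <= s by apply: ub_le_sup; [exact: Badsup.2|split].
  apply: nU; apply: dP; rewrite ler0_norm ?subr_le0//.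
  by move: ud; rewrite -/s; lra.
have {}st0 : s < t0.
  by rewrite lt_neqAle st0 andbT; apply/eqP => st; apply: nUs; rewrite st.
have Ks : chart_ball c p e1 (rayt q s).
  apply: contrapT => nK.
  have nKo : \forall m \near rayt q s, ~ chart_ball c p e1 m.
    by apply: open_nbhs_nbhs; split => //; exact: closed_openC.
  have [d d0 dP] := (near_norm _ _).1 (orbit_near1 htau one_parameter_ray nKo).
  pose u := Num.min t0 (s + d / 2).
  have su : s < u by rewrite lt_min st0 ltrDl divr_gt0.
  have ut0 : u <= t0 by rewrite ge_min lexx.
  have ud : u <= s + d / 2 by rewrite ge_min lexx orbT.
  apply: (dP u); first by rewrite gtr0_norm ?subr_gt0//; lra.
  by have [? /ltW ?] := after u su ut0.
apply: nUs; split; first by case: Ks.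
have Kt u : s <= u <= t0 -> chart_ball c p e1 (rayt q u).
  move=> /andP[su ut0]; have [->//|us] := eqVneq u s.
  have su' : s < u by rewrite lt_neqAle eq_sym us.
  by have [? /ltW ?] := after u su' ut0.
have disp : `|c (rayt q t0) - c (rayt q s)| <= 2 * (e1 / 8).
  apply: (mean_displacement htau Ac cp eta0 L0 r0 XL (ltW st0)) => u v ut0 v2pi.
  have uT : u < T by case/andP: ut0 => _ ut0; exact: le_lt_trans t0T.
  have Ku := Kt u ut0; have [du ue] := TP u v uT Ku v2pi.
  split=> //; last exact: ltW.
  rewrite -(subrKA (c (rayt q u))); apply: le_lt_trans (ler_normD _ _) _.
  case: Ku => _; lra.
rewrite -(subrKA (c (rayt q t0))); apply: le_lt_trans (ler_normD _ _) _.
rewrite distrC; lra.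
Qed.

Lemma alpha_limit_converges q p : alpha_limit q p -> tau z q @[z --> (0 : R[i]^o)^'] --> p.
Proof.
move=> qp P Pp; have [c Ac cp] := atlas_cover (kahler_atlas hM) p.
have [e e0 eP] := (near_norm _ _).1 (near_chart_inv cp Pp).
have [T TP] := alpha_limit_trap Ac qp cp e0.
apply: (@near_zero_polar R (fun z => P (tau z q)) T) => t s tT s2pi.
rewrite (actionM htau) ?toC_ray_neq0 ?toC_cir_neq0// (ray_cir_comm htau).
have [ds se] := TP t s tT s2pi.
by rewrite -(chart_funK ds); exact: eP.
Qed.

End Convergence.

(** * The moment map near a critical point *)

Section CriticalValues.
Context {R : realType} {n : nat} {M : topologicalType}.
Context {A : set (chart R n M)} {om : chart R n M -> Cspace R n -> 'M[R]_(n + n)}.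
Context {tau : R[i] -> M -> M} {phi : M -> R}.
Context (hM : compact_kahler A om) (htau : Cstar_holomorphic_action A tau).
Context (hphi : hamiltonian A om tau phi).
Implicit Types (c d : chart R n M) (p q : M).

Notation eta := (inf_gen (tau := tau) (1, 0)).
Notation xi := (inf_gen (tau := tau) (0, 1)).
Notation rayt q t := (tau (toC (ray t)) q).
Notation cirt q t := (tau (toC (cir t)) q).

(** [d phi = - om (xi, _)] and the coefficients of [om] are bounded near [c p]. *)
Lemma moment_derive_le c p : A c -> chart_dom c p ->
  exists2 C : R, 0 <= C & \forall x \near c p, forall v,
    `|'D_v (phi \o chart_inv c) x| <= C * `|xi c x| * `|v|.
Proof.
move=> Ac cp; pose W := `|om c (c p)| + 1.
have omc : om c x @[x --> c p] --> om c (c p).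
  have [H _] := kahler_smooth (kahler_kahler_form hM) Ac 1.
  exact: (differentiable_continuous (H _ (chart_img_fun cp))).
have omW : \forall x \near c p, `|om c x| <= W.
  have [e e0 eP] := (near_norm _ _).1 ((cvgrPdist_le _ _).1 omc 1 ltr01).
  apply/near_norm; exists e => // x /eP xe.
  rewrite -(subrK (om c (c p)) (om c x)) /W addrC; apply: le_trans (ler_normD _ _) _.
  by rewrite lerD2l distrC.
exists ((n + n)%:R ^+ 2 * W); first by rewrite mulr_ge0 ?sqr_ge0 ?addr_ge0.
apply: filterS2 omW (near_chart_img (chart_img_fun cp)) => x xW cx v.
rewrite (moment_derive htau hphi)// -(inf_gen_J htau)// normrN.
apply: le_trans (bform_le _ _ _) _.
by rewrite ler_wpM2r// ler_wpM2r// ler_wpM2l// sqr_ge0.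
Qed.

Lemma real_mvt (f df : R -> R) (m : R) :
  (forall t : R, 0 <= t <= 1 -> is_derive t 1 f (df t)) ->
  (forall t : R, 0 <= t <= 1 -> `|df t| <= m) -> `|f 1 - f 0| <= m.
Proof.
move=> fd dfm.
have cf : {within `[0, 1], continuous f}.
  by apply: derivable_within_continuous => t /[!in_itv] /= /fd[].
have fd' (t : R) : t \in `]0, 1[ -> is_derive t 1 f (df t).
  by rewrite in_itv/= => /andP[t0 t1]; apply: fd; rewrite !ltW.
have [t /[!in_itv] /= t01 ->] := MVT_segment ler01 fd' cf.
by rewrite subr0 mulr1 dfm.
Qed.

(** [periodic_fixed_points_level] for the rotation [g] by the angle
    [h = 2 pi / N.+1].  For [h] small [short_arc] bounds the generator
    [xi] at [x] by [2 / h * |g x - x|], and [xi] bounds the differential of [phi]. *)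
Lemma moment_near_fixed c p : A c -> chart_dom c p -> eta c (c p) = 0 ->
  \forall m \near p, (forall t, cirt m t = m) -> phi m = phi p.
Proof.
move=> Ac cp eta0.
have pfix := zero_fixed htau Ac cp eta0.
have [L L0 [r r0 XL]] := inf_gen_lipschitz htau (0, 1) Ac cp.
have [C C0 Cder] := moment_derive_le Ac cp.
have near_r : \forall m \near cirt p 0, chart_dom c m /\ `|c m - c p| < r.
  rewrite pfix; apply: (near_chart_fun (P := fun x => `|x - c p| < r)) => //.
  by apply/near_norm; exists r.
(* arcs of duration [h1] stay where [xi] is [L]-Lipschitz *)
have [h1 h10 arcs] : exists2 h1 : R, 0 < h1 & \forall m \near p,
    forall t, 0 <= t <= h1 -> chart_dom c (cirt m t) /\ `|c (cirt m t) - c p| < r.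
  have [[U V] /= [/near_norm[s s0 sU] Vp] UV] := orbit_near htau one_parameter_cir near_r.
  exists (s / 2); first by rewrite divr_gt0.
  apply: filterS Vp => m Vm t /andP[t0 ts]; apply: (UV (t, m)); split => //=.
  by apply: sU; rewrite subr0 ger0_norm//; lra.
have pi0 : 0 < (pi *+ 2 : R) by rewrite mulrn_wgt0// pi_gt0.
have [N [h [h0 hN hL hh1]]] : exists N : nat, exists h : R,
    [/\ 0 < h, h * N.+1%:R = pi *+ 2, h * L <= 4^-1 & h <= h1].
  pose N := Num.bound ((pi *+ 2) * (4 * L + h1^-1)).
  have bN : (pi *+ 2) * (4 * L + h1^-1) <= N.+1%:R.
    apply: (@le_trans _ _ N%:R); last by rewrite ler_nat.
    apply: ltW; apply: archi_boundP; rewrite mulr_ge0 ?(ltW pi0)//.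
    by rewrite addr_ge0 ?mulr_ge0// invr_ge0 ltW.
  rewrite mulrDr in bN.
  have b1 : 0 <= (pi *+ 2) * (4 * L) by rewrite !mulr_ge0// ltW.
  have b2 : 0 <= (pi *+ 2) / h1 by rewrite divr_ge0 ?ltW.
  exists N, ((pi *+ 2) / N.+1%:R); split.
  - by rewrite divr_gt0.
  - by rewrite divfK.
  - rewrite mulrAC ler_pdivrMr// ler_pdivlMl//; lra.
  - rewrite ler_pdivrMr// mulrC -ler_pdivrMr//; lra.
pose g x := act (tau := tau) c c (cir h, x).
pose f := phi \o chart_inv c.
have gp : g (c p) = c p by rewrite /g /act /= chart_funK// pfix.
have [dg cg] : (\forall x \near c p, differentiable g x) /\
    (forall v, {for c p, continuous ('D_v g)}).
  have [|dact Dact] := act_C1 htau Ac Ac (op_neq0 one_parameter_cir h) cp.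
    by rewrite pfix.
  apply: C1_slice => // u; apply: differentiable_continuous.
  by have [/nbhs_singleton] := Dact u.
have dgp : differentiable g (c p) := nbhs_singleton dg.
have strict := C1_strict_derivative dg cg.
have gB : strict_derivative g (c p) ('d g (c p)).
  rewrite (_ : ('d g (c p) : _ -> _) = fun v => 'D_v g (c p))//.
  by apply/funext => v; rewrite deriveE.
have [K K0 [r1 r10 gK]] := C1_lipschitz dg cg.
have g_iter m j : chart_dom c m ->
    (forall t, 0 <= t <= pi *+ 2 -> chart_dom c (cirt m t)) -> (j <= N.+1)%N ->
    iter j g (c m) = c (cirt m (h * j%:R)).
  move=> cm mdom; elim: j => [_|j IH jN].
    by rewrite mulr0 (orbit_0 htau one_parameter_cir).
  rewrite /= IH 1?ltnW// /g /act /= chart_funK.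
    rewrite -(orbit_add htau one_parameter_cir); congr (c (cirt m _)).
    by rewrite -natr1 mulrDr mulr1 addrC.
  apply: mdom; rewrite mulr_ge0 ?(ltW h0)//= -hN ler_wpM2l ?(ltW h0)//.
  by rewrite ler_nat ltnW// ltnW.
have near_iter : \forall x \near c p, iter N.+1 g x = x.
  have tube := circle_tube htau pfix (near_chart_dom cp).
  apply: filterS2 (near_chart_inv cp tube) (near_chart_img (chart_img_fun cp)).
  move=> x xdom cx; have := g_iter (chart_inv c x) N.+1 (chart_inv_dom cx) xdom (leqnn _).
  rewrite chart_invK// hN => ->.
  have -> : toC (cir (pi *+ 2 : R)) = 1 by rewrite /toC /= cos2pi sin2pi.
  by rewrite (action1 htau) chart_invK.
have near_xi : \forall x \near c p, `|xi c x| <= 2 / h * `|g x - x|.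
  apply: filterS2 (near_chart_inv cp arcs) (near_chart_img (chart_img_fun cp)).
  move=> x xarc cx.
  have qB (t : R) : 0 <= t <= h ->
      chart_dom c (cirt (chart_inv c x) (0 + t)) /\
      `|c (cirt (chart_inv c x) (0 + t)) - c p| < r.
    by move=> /andP[t0 th]; rewrite add0r; apply: xarc; rewrite t0 (le_trans th).
  have [_] := short_arc htau Ac L0 XL (ltW h0) hL qB.
  rewrite /= (orbit_0 htau one_parameter_cir) chart_invK// -[c (cirt _ h)]/(g x).
  set D := g x - x; set X := xi c x => DX.
  have H : h * `|X| <= `|D| + 2 * h ^+ 2 * L * `|X|.
    rewrite -{1}(ger0_norm (ltW h0)) -normrZ -(subrK D (h *: X)) addrC.
    by apply: le_trans (ler_normD _ _) _; rewrite lerD2l distrC.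
  have H2 : 2 * h ^+ 2 * L * `|X| <= h / 2 * `|X|.
    rewrite ler_wpM2r//.
    have -> : 2 * h ^+ 2 * L = 2 * h * (h * L) by ring.
    have -> : h / 2 = 2 * h * 4^-1 by field.
    by rewrite ler_wpM2l// mulr_ge0// ltW.
  rewrite -mulrA mulrCA ler_pdivlMl//; lra.
have [rho rho0 rhoP] : exists2 rho : R, 0 < rho & forall x, `|x - c p| < rho ->
    [/\ iter N.+1 g x = x, `|xi c x| <= 2 / h * `|g x - x|,
      (forall v, `|'D_v f x| <= C * `|xi c x| * `|v|) & differentiable f x].
  have near_df : \forall x \near c p, differentiable f x.
    apply: filterS (near_chart_img (chart_img_fun cp)) => x cx.
    have := differentiable_moment hphi Ac (chart_inv_dom cx).
    by rewrite chart_invK.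
  apply/near_norm; near=> x; split; near: x => //.
pose r2 := Num.min rho (Num.min r r1).
have r20 : 0 < r2 by rewrite !lt_min rho0 r0.
have [r2rho r2r r2r1] : [/\ r2 <= rho, r2 <= r & r2 <= r1].
  by rewrite !ge_min !lexx !orbT.
clearbody r2.
pose C' := C * (2 / h + L).
have C'0 : 0 <= C' by rewrite mulr_ge0// addr_ge0// divr_ge0// ltW.
have fC a b : `|a - c p| < r2 -> `|b - c p| < r2 ->
    `|f a - f b| <= C' * (`|g a - a| + `|a - b|) * `|a - b|.
  move=> ar br.
  pose y (t : R) := b + t *: (a - b).
  have yr t : 0 <= t <= 1 -> `|y t - c p| < r2 by exact: segment_ball.
  have -> : f a - f b = f (y 1) - f (y 0).
    by rewrite /y scale1r scale0r addr0 [b + _]addrC subrK.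
  apply: (@real_mvt (f \o y) (fun t => 'D_(a - b) f (y t))) => t t01.
    apply: is_derive_comp; first exact: is_derive_line.
    by have [] := rhoP _ (lt_le_trans (yr t t01) r2rho).
  have [_ _ Df _] := rhoP _ (lt_le_trans (yr t t01) r2rho).
  have [_ xia _ _] := rhoP _ (lt_le_trans ar r2rho).
  apply: le_trans (Df _) _; rewrite ler_wpM2r// /C' -mulrA ler_wpM2l//.
  have yXL := XL _ _ (lt_le_trans (yr t t01) r2r) (lt_le_trans ar r2r).
  have ya : `|y t - a| <= `|a - b|.
    have -> : y t - a = (t - 1) *: (a - b).
      by rewrite scalerBl scale1r opprB addrA [t *: _ + b]addrC.
    rewrite normrZ ler_piMl//; case/andP: t01 => t0 t1.
    by rewrite ler0_norm ?subr_le0//; lra.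
  rewrite -(subrK (xi c a) (xi c (y t))); apply: le_trans (ler_normD _ _) _.
  have Lya : L * `|y t - a| <= L * `|a - b| by rewrite ler_wpM2l.
  have E1 : 0 <= 2 / h * `|a - b| by rewrite mulr_ge0// divr_ge0// ltW.
  have E2 : 0 <= L * `|g a - a| by rewrite mulr_ge0.
  by rewrite mulrDl !mulrDr; lra.
have level := @periodic_fixed_points_level R (n + n) g f ('d g (c p)) (c p) N.+1
  C' (K + 1) r2 r20 isT C'0 _ gp gB _ _ fC.
have {}level : \forall x \near c p, g x = x -> f x = f (c p).
  apply: level.
  - by rewrite lerDr.
  - move=> a b ar br; apply: le_trans (gK a b _ _) _.
    + exact: lt_le_trans r2r1.
    + exact: lt_le_trans r2r1.
    + by rewrite ler_wpM2r// lerDl.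
  - by move=> a ar; have [] := rhoP a (lt_le_trans ar r2rho).
apply: filterS (near_chart_fun cp level) => m [cm mP] mfix.
have := mP; rewrite /f /g /act /= !chart_funK// mfix; exact.
Unshelve. all: by end_near. Qed.

End CriticalValues.

(** * The decomposition *)

Section Decomposition.
Context {R : realType} {n : nat} {M : topologicalType}.
Context {A : set (chart R n M)} {om : chart R n M -> Cspace R n -> 'M[R]_(n + n)}.
Context {tau : R[i] -> M -> M} {phi : M -> R}.
Context (hM : compact_kahler A om) (htau : Cstar_holomorphic_action A tau).
Context (hphi : hamiltonian A om tau phi).
Implicit Types (c d : chart R n M) (p q : M).

Notation eta := (inf_gen (tau := tau) (1, 0)).
Notation rayt q t := (tau (toC (ray t)) q).
Notation cirt q t := (tau (toC (cir t)) q).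

Lemma critical_eta p c : critical_points A phi p -> A c -> chart_dom c p ->
  eta c (c p) = 0.
Proof.
move=> crit Ac cp; apply: (moment_derive_eta_eq0 hM htau hphi) => //.
  exact: chart_img_fun.
exact: crit.
Qed.

Lemma alpha_limit_critical_points q p : alpha_limit (tau := tau) q p -> critical_points A phi p.
Proof.
move=> qp c v Ac cp; rewrite (moment_derive htau hphi)//; last exact: chart_img_fun.
by rewrite (alpha_limit_critical hM htau hphi qp)// multJ0 /bform !mul0mx mxE oppr0.
Qed.

(** [phi] is locally constant on the critical set, so its level through [p] is
    open and closed in the component of [p]. *)
Lemma moment_const_component p m : critical_points A phi p ->
  connected_component (critical_points A phi) p m -> phi m = phi p.
Proof.
move=> pcrit; set K := connected_component _ p => Km.
have Kcrit : K `<=` critical_points A phi by exact: connected_component_sub.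
pose P := [set x | critical_points A phi x -> phi x = phi p].
suff KE : K `&` [set x | phi x = phi p] = K.
  by have [] : (K `&` [set x | phi x = phi p]) m by rewrite KE.
apply: (@component_connected _ (critical_points A phi) p).
- by exists p; split => //; exact: connected_component_refl.
- exists (interior P); first exact: open_interior.
  apply/seteqP; split=> x [Kx].
    move=> /= xp; split => //.
    have [c Ac cx] := atlas_cover (kahler_atlas hM) x.
    have := moment_near_fixed hM htau hphi Ac cx (critical_eta (Kcrit _ Kx) Ac cx).
    apply: filterS => y yx ycrit; rewrite -xp; apply: yx => t.
    have [d Ad dy] := atlas_cover (kahler_atlas hM) y.
    exact: (zero_fixed htau Ad dy (critical_eta ycrit Ad dy)).
  by move=> /interior_subset Px; split => //; exact/Px/Kcrit.
- exists (phi @^-1` [set phi p]) => //; apply: preimage_closed; last exact: closed_eq.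
  by move=> x _; exact: (moment_continuous hM hphi).
Qed.

(** [phi (tau_z q)] depends only on [|z|]. *)
Lemma moment_polar q (t s : R) : phi (tau (toC (ray t) * toC (cir s)) q) = phi (rayt q t).
Proof.
rewrite (actionM htau) ?toC_ray_neq0 ?toC_cir_neq0// (ray_cir_comm htau).
exact: (moment_cir hM htau hphi).
Qed.

Lemma tauK z q : z != 0 -> tau z^-1 (tau z q) = q.
Proof. by move=> z0; rewrite -(actionM htau) ?invr_eq0// mulVf// (action1 htau). Qed.

Lemma limit_is_alpha_limit q p : tau z q @[z --> (0 : R[i]^o)^'] --> p ->
  alpha_limit (tau := tau) q p.
Proof.
move=> qp a U Up; have [T TU] := ray_near_zero (qp U Up).
exists (Num.min a T - 1); first by rewrite ltrBlDr ltr_pwDr// ge_min lexx.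
by apply: TU; rewrite ltrBlDr ltr_pwDr// ge_min lexx orbT.
Qed.

Lemma limit_above q p lambda : tau z q @[z --> (0 : R[i]^o)^'] --> p ->
  lambda < phi p -> ~ Msharp tau phi lambda q.
Proof.
move=> /limit_is_alpha_limit qp lp.
have above z : z != 0 -> lambda < phi (tau z q).
  move=> /polar[t [s _ ->]]; rewrite moment_polar.
  exact: lt_le_trans lp (moment_ge_alpha_limit hM htau hphi t qp).
case=> [ql|[z z0 [p' p'l zq]]].
  have := above 1 (oner_neq0 _); rewrite (action1 htau).
  by move: ql; rewrite /Mo /= => /lt_trans /[apply]; rewrite ltxx.
have := above z^-1; rewrite invr_eq0 => /(_ z0); rewrite -zq tauK//.
by move: p'l => /= ->; rewrite ltxx.
Qed.

Lemma not_Msharp_above q lambda t : ~ Msharp tau phi lambda q ->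
  lambda < phi (rayt q t).
Proof.
move=> nq.
have ql : lambda <= phi q by rewrite leNgt; apply/negP => ql; apply: nq; left.
have ne s : phi (rayt q s) <> lambda.
  move=> sl; apply: nq; right; exists (toC (ray s))^-1.
    by rewrite /= invr_eq0 toC_ray_neq0.
  by exists (rayt q s) => //; rewrite tauK// toC_ray_neq0.
rewrite ltNge; apply/negP => tl.
have q0 : rayt q 0 = q by exact: (orbit_0 htau one_parameter_ray).
have [t0|t0] := leP 0 t.
  have := moment_ray_le hM htau hphi q t0; rewrite q0 => qt.
  by apply: (ne t); apply/eqP; rewrite eq_le tl (le_trans ql).
pose f (s : R) := phi (rayt q s).
have cf : {within `[t, 0], continuous f}.
  apply: continuous_in_subspaceT => s _ U Us.
  have pc := moment_continuous hM hphi (x := rayt q s) Us.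
  exact: (orbit_near1 htau one_parameter_ray pc).
have [s _ sl] : exists2 s, s \in `[t, 0] & f s = lambda.
  apply: IVT cf _; first exact: ltW.
  by rewrite /f q0 ge_min tl /= le_max ql orbT.
exact: ne sl.
Qed.

End Decomposition.

Theorem mainTheorem2 (R : realType) (n : nat) (M : topologicalType)
  (A : set (chart R n M)) (om : chart R n M -> 'rV[R]_(n + n) -> 'M[R]_(n + n))
  (tau : complex R -> M -> M) (phi : M -> R) (lambda : R)
  (I : Type) (F : I -> set M)
  (hM : compact_kahler A om)
  (htau : Cstar_holomorphic_action A tau)
  (hphi : hamiltonian A om tau phi)
  (hfree : circle_acts_freely tau (phi @^-1` [set lambda]))
  (hF : range F = components (critical_points A phi)) :
  ~` Msharp tau phi lambda =
  \bigcup_(i in [set i | exists2 a, has_value phi (F i) a & lambda < a])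
    unstable tau (F i).
Proof.
apply/seteqP; split=> [q nq|q [i [a Fia la] [p Fp qp]]]; last first.
  apply: (limit_above hM htau hphi qp).
  have : (phi @` F i) (phi p) by exists p.
  by rewrite Fia => ->.
have [p qp] := alpha_limit_exists hM (tau := tau) q.
have pcrit := alpha_limit_critical_points hM htau hphi qp.
have lp : lambda <= phi p.
  rewrite leNgt; apply/negP => pl.
  have pc : phi m @[m --> p] --> phi p by exact: (moment_continuous hM hphi).
  have near_l : \forall m \near p, phi m < lambda by exact: cvgr_lt pc _ pl.
  have [t _ tl] := qp 0 _ near_l.
  have := not_Msharp_above hM htau hphi t nq.
  by move=> /(lt_trans tl); rewrite ltxx.
have lp' : lambda < phi p.
  rewrite lt_neqAle lp andbT; apply/eqP => lpE.
  have pfix := alpha_limit_fixed hM htau hphi pi qp.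
  have := hfree p (toC (cir pi)) (esym lpE) (norm_toC_cir _) pfix.
  move=> -[]; rewrite cospi => /eqP.
  by rewrite -subr_eq0 -opprD oppr_eq0 (_ : 1 + 1 = 2%:R)// pnatr_eq0.
have : components (critical_points A phi) (connected_component (critical_points A phi) p).
  by exists p.
rewrite -hF => -[i _ Fi].
have Fip : F i p by rewrite Fi; exact: connected_component_refl.
exists i; last by exists p => //; exact: (alpha_limit_converges hM htau hphi qp).
exists (phi p) => //; apply/seteqP; split=> [_ [m Fm <-]|_ ->]; last by exists p.
by apply: (moment_const_component hM htau hphi pcrit); rewrite -Fi.
Qed.
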